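(* (1) For every integer $m>1$, there is no $q$-matroid on $\mathbb F_2^3$ that is purely $m$-multilinear. (2) For every integer $m$ with $1<m<4$, there is no $q$-matroid on $\mathbb F_2^4$ that is purely $m$-multilinear.
   Context: Here $q=2$ and $E=\mathbb F_2^n$ with $n\in\{3,4\}$; $\mathcal L(E)$ is the set of subspaces of $E$ and $U^\perp$ the orthogonal complement under the standard dot product. A $q$-matroid on $E$ is $(\mathcal L(E),\rho)$ with $\rho:\mathcal L(E)\to\mathbb Z$ satisfying $0\le\rho(A)\le\dim A$, monotonicity, and submodularity $\rho(A\cap B)+\rho(A+B)\le\rho(A)+\rho(B)$. For an $\mathbb F_2$-linear $\mathcal C\subseteq\mathbb F_2^{n\times m}$ of dimension $k'$, $\rho_{\mathcal C}(U)=(k'-\dim\mathcal C(U^\perp))/m$ with $\mathcal C(W)=\{M\in\mathcal C:\operatorname{colsp}(M)\subseteq W\}$; a $q$-matroid is $\mathbb F_2^{n\times m}$-representable if its rank function is $\rho_{\mathcal C}$ for some such $\mathcal C$. For $x\in\mathbb F_{2^m}^n$, $\operatorname{supp}(x)$ is the column space of the $n\times m$ binary matrix expanding the coordinates of $x$ in a fixed $\mathbb F_2$-basis of $\mathbb F_{2^m}$; a $q$-matroid is $\mathbb F_{2^m}$-representable if its rank function is $W\mapsto K-\dim_{\mathbb F_{2^m}}\{x\in\mathcal C:\operatorname{supp}(x)\subseteq W^\perp\}$ for some $\mathbb F_{2^m}$-linear $\mathcal C\subseteq\mathbb F_{2^m}^n$ of dimension $K$. For $m>1$, a $q$-matroid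 is purely $m$-multilinear if it is $\mathbb F_2^{n\times m}$-representable but not $\mathbb F_{2^m}$-representable. *)

(* Defs.v *)
From HB Require Import structures.
From mathcomp Require Import all_boot all_order all_algebra all_field.

Set Implicit Arguments.
Unset Strict Implicit.
Unset Printing Implicit Defensive.

Import Order.TTheory GRing.Theory Num.Theory.
Local Open Scope ring_scope.

Definition ortho (n : nat) (U : {vspace 'cV['F_2]_n}) : {vspace 'cV['F_2]_n} :=
  (\bigcap_(u : 'cV['F_2]_n | u \in U) lker (linfun (mulmx u^T)))%VS.

Lemma mem_ortho (n : nat) (U : {vspace 'cV['F_2]_n}) (v : 'cV['F_2]_n) :
  reflect (forall u, u \in U -> \sum_(i < n) u i 0 * v i 0 = 0) (v \in ortho U).
Proof.
have dotE (u : 'cV['F_2]_n) : (v \in lker (linfun (mulmx u^T))) =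
    (\sum_(i < n) u i 0 * v i 0 == 0).
  rewrite memv_ker lfunE /=; apply/eqP/eqP => [/matrixP/(_ 0 0)|uv0].
    by rewrite !mxE => uv0; rewrite -[RHS]uv0; apply: eq_bigr => i _; rewrite mxE.
  apply/matrixP=> i j; rewrite !ord1 !mxE -[RHS]uv0.
  by apply: eq_bigr => k _; rewrite mxE.
apply: (iffP idP) => [vU u uU|vU].
  have /subv_bigcapP/(_ u uU) : (<[v]> <= ortho U)%VS by rewrite -memvE.
  by rewrite -memvE dotE => /eqP.
by rewrite memvE; apply/subv_bigcapP => u uU; rewrite -memvE dotE; apply/eqP/vU.
Qed.

Record qmatroid (n : nat) := QMatroid {
  rk :> {vspace 'cV['F_2]_n} -> int;
  rk_bounds : forall A, 0 <= rk A <= (\dim A)%:Z;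
  rk_mono : forall A B, (A <= B)%VS -> rk A <= rk B;
  rk_submod : forall A B, rk (A :&: B)%VS + rk (A + B)%VS <= rk A + rk B
}.

Definition colsp (n m : nat) (A : 'M['F_2]_(n, m)) : {vspace 'cV['F_2]_n} :=
  <<[seq col j A | j <- enum 'I_m]>>%VS.

Lemma colsp_sub (n m : nat) (A : 'M['F_2]_(n, m)) (W : {vspace 'cV['F_2]_n}) :
  (colsp A <= W)%VS = [forall j, col j A \in W].
Proof.
apply/span_subvP/forallP => [AW j|AW _ /mapP[j _ ->]]; last exact: AW.
by apply: AW; apply: map_f; rewrite mem_enum.
Qed.

Lemma mem_span_closed (K : fieldType) (vT : vectType K) (s : seq vT) :
  0 \in s ->
  (forall (a : K) (u v : vT), u \in s -> v \in s -> a *: u + v \in s) ->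
  <<s>>%VS =i s.
Proof.
move=> s0 sL v; apply/idP/idP => [|/memv_span //].
rewrite -[s in <<s>>%VS]/(tval (in_tuple s)) => /coord_span ->.
apply: (big_ind (fun x => x \in s)) => // [x y xs ys|i _].
  by have := sL 1 x y xs ys; rewrite scale1r.
by rewrite -[_ *: _]addr0; apply: sL => //; apply: mem_nth.
Qed.

(* C(W): the span adds nothing, see mem_shorten. *)
Definition shorten (n m : nat) (C : {vspace 'M['F_2]_(n, m)})
    (W : {vspace 'cV['F_2]_n}) : {vspace 'M['F_2]_(n, m)} :=
  <<enum [pred A : 'M['F_2]_(n, m) | (A \in C) && (colsp A <= W)%VS]>>%VS.

Lemma mem_shorten (n m : nat) (C : {vspace 'M['F_2]_(n, m)})
    (W : {vspace 'cV['F_2]_n}) (A : 'M['F_2]_(n, m)) :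
  (A \in shorten C W) = (A \in C) && (colsp A <= W)%VS.
Proof.
rewrite mem_span_closed ?mem_enum // => [|a u v]; rewrite ?mem_enum !inE.
  rewrite mem0v colsp_sub; apply/forallP => j.
  by rewrite linear0 mem0v.
move=> /andP[uC uW] /andP[vC vW].
rewrite memvD ?memvZ //=; move: uW vW; rewrite !colsp_sub.
move=> /forallP uW /forallP vW; apply/forallP => j.
have -> : col j (a *: u + v) = a *: col j u + col j v.
  by apply/colP => i; rewrite !mxE.
by rewrite memvD ?memvZ ?uW ?vW.
Qed.

Definition matrix_representable (n m : nat) (M : qmatroid n) : Prop :=
  exists C : {vspace 'M['F_2]_(n, m)}, forall U : {vspace 'cV['F_2]_n},
    (M U)%:~R = ((\dim C)%:R - (\dim (shorten C (ortho U)))%:R) / m%:R :> rat.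

Section VectorCodes.

(* b is meant to be a basis of L over 'F_2, so that L has 2 ^ m elements; this
   is assumed where it is needed. *)
Variables (n m : nat) (L : fieldExtType 'F_2) (b : m.-tuple L).

Definition expand (x : 'cV[L]_n) : 'M['F_2]_(n, m) :=
  \matrix_(i < n, j < m) coord b j (x i 0).

Definition supp (x : 'cV[L]_n) : {vspace 'cV['F_2]_n} := colsp (expand x).

(* The span adds nothing, see mem_vshorten; finvect_type only makes L a
   finType, so that the vectors can be enumerated. *)
Definition vshorten (C : {vspace 'cV[L]_n}) (W : {vspace 'cV['F_2]_n}) :
    {vspace 'cV[L]_n} :=
  <<enum [pred x : 'cV[finvect_type L]_n | (x \in C) && (supp x <= W)%VS]>>%VS.

Lemma mem_vshorten (C : {vspace 'cV[L]_n}) (W : {vspace 'cV['F_2]_n})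
    (x : 'cV[L]_n) :
  basis_of fullv b -> (x \in vshorten C W) = (x \in C) && (supp x <= W)%VS.
Proof.
move=> bP; pose P := [pred y : 'cV[finvect_type L]_n |
  (y \in C) && (supp y <= W)%VS].
have enumE (y : 'cV[L]_n) : (y \in (enum P : seq 'cV[L]_n)) =
  (y \in C) && (supp y <= W)%VS
  by have := mem_enum P y.
rewrite mem_span_closed -/P => [|| a u v]; rewrite ?enumE //.
  rewrite mem0v /supp colsp_sub; apply/forallP => j.
  suff -> : col j (expand 0) = 0 by rewrite mem0v.
  by apply/colP => i; rewrite !mxE linear0.
move=> /andP[uC uW] /andP[vC vW].
rewrite memvD ?memvZ //=; move: uW vW; rewrite /supp !colsp_sub.
move=> /forallP uW /forallP vW; apply/forallP => j.
suff -> : col j (expand (a *: u + v)) =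
    \sum_(k < m) coord b j (a * b`_k) *: col k (expand u) + col j (expand v).
  by rewrite memvD // memv_suml // => k _; rewrite memvZ.
apply/colP => i; rewrite !mxE linearD summxE /=; congr (_ + _).
rewrite {1}(coord_basis bP (memvf (u i 0))) mulr_sumr linear_sum /=.
by apply: eq_bigr => k _; rewrite !mxE -scalerAr linearZ /= mulrC.
Qed.

Definition field_representable (M : qmatroid n) : Prop :=
  exists C : {vspace 'cV[L]_n}, forall W : {vspace 'cV['F_2]_n},
    M W = (\dim C)%:Z - (\dim (vshorten C (ortho W)))%:Z.

Definition purely_multilinear (M : qmatroid n) : Prop :=
  [/\ (1 < m)%N, matrix_representable m M & ~ field_representable M].

End VectorCodes.

(* Main.v *)
(** Write C(W) for the matrices of a code C whose columns lie in W.  Since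
    U |-> U^perp is an involution, it is enough to find, for each binary code C
    with m | dim C(W) for all W, an L-linear code C' in L^n with
    dim C(W) = m dim_L C'(W) for all W.  Put dim C = m k.

    - k = 1: every nonzero A in C generates such a code, because
      C(W) <> 0 forces C(W) = C.
    - C has codimension m among the matrices with columns in some W0 (this covers
      k = n - 1): a functional B vanishing on C yields a vector a in L^n, and C'
      is the set of the x supported in W0 with a.x = 0.
    - n = 4, k = 2, and C not inside any hyperplane: if C contains all the
      matrices with columns on a line <w>, take C' = L w + L a for any other word
      a.  Otherwise all nonzero words have rank at least 2.  For m = 2 the code is
      closed under multiplication by a primitive cube root of unity.  For m = 3,
      double counting shows that the words of rank 2 lie on exactly three planes;
      these are the column spaces of words A, B and A + B, and C' is spanned by
      A and B over L. *)
From HB Require Import structures.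
From mathcomp Require Import all_boot all_order all_algebra all_field.
From mathcomp Require Import zify.
Require Import Defs.

Set Implicit Arguments.
Unset Strict Implicit.
Unset Printing Implicit Defensive.

Import Order.TTheory GRing.Theory Num.Theory.
Local Open Scope ring_scope.

(** * Shortened codes and orthogonal complements *)

(** A right inverse of [X] makes left multiplication by [X] surjective, so rank-nullity gives the
    dimension of the kernel. *)
Lemma dim_lker_mulmx (F : fieldType) (k n p : nat) (X : 'M[F]_(k, n)) :
  row_free X ->
  \dim (lker (linfun (mulmx X : 'M_(n, p) -> 'M_(k, p)))) = ((n - k) * p)%N.
Proof.
move=> /row_freeP[Y XY]; set f := linfun _.
have imf : limg f = fullv.
  apply/vspaceP=> B; rewrite memvf -[B]mul1mx -XY -mulmxA.
  have -> : X *m (Y *m B) = f (Y *m B) by rewrite lfunE.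
  by rewrite memv_img ?memvf.
have := limg_ker_dim f fullv.
by rewrite imf capfv !dimvf !dim_matrix => E; rewrite mulnBl -[(n * p)%N]E addnK.
Qed.

Lemma colsp_subP (n m : nat) (A : 'M['F_2]_(n, m)) (W : {vspace 'cV['F_2]_n}) :
  reflect (forall j, col j A \in W) (colsp A <= W)%VS.
Proof. by rewrite colsp_sub; apply: forallP. Qed.

(** Its rows are a basis of [U], which makes it a parity-check matrix of [ortho U]. *)
Definition basis_mx (n : nat) (U : {vspace 'cV['F_2]_n}) : 'M['F_2]_(\dim U, n) :=
  \matrix_(i, j) (vbasis U)`_i j 0.

Lemma row_free_basis_mx (n : nat) (U : {vspace 'cV['F_2]_n}) :
  row_free (basis_mx U).
Proof.
apply/inj_row_free => v vX0; apply/rowP => i; rewrite mxE.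
have /freeP-/(_ (v 0)) := basis_free (vbasisP U); apply.
apply/colP => j; move/rowP/(_ j): vX0; rewrite !mxE summxE => vX0.
by rewrite -[RHS]vX0; apply: eq_bigr => k _; rewrite !mxE.
Qed.

Lemma basis_mx_mul (n : nat) (U : {vspace 'cV['F_2]_n}) (v : 'cV['F_2]_n) :
  (v \in ortho U) = (basis_mx U *m v == 0).
Proof.
apply/mem_ortho/eqP => [vU|Uv u uU].
  apply/colP => i; rewrite !mxE -[RHS](vU (vbasis U)`_i).
    by apply: eq_bigr => j _; rewrite mxE.
  by apply: vbasis_mem; rewrite mem_nth ?size_tuple.
rewrite (coord_vbasis uU).
under eq_bigr => i _ do rewrite summxE mulr_suml.
rewrite exchange_big big1 //= => k _.
move/colP/(_ k): Uv; rewrite !mxE => Uv.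
rewrite -[RHS](mulr0 (coord (vbasis U) k u)) -[in RHS]Uv mulr_sumr.
by apply: eq_bigr => i _; rewrite !mxE mulrA.
Qed.

Lemma dim_ortho (n : nat) (U : {vspace 'cV['F_2]_n}) :
  \dim (ortho U) = (n - \dim U)%N.
Proof.
rewrite -[RHS]muln1 -(dim_lker_mulmx 1 (row_free_basis_mx U)).
congr (\dim _); apply/vspaceP => v.
by rewrite memv_ker lfunE basis_mx_mul.
Qed.

Lemma dim_col_le (n : nat) (U : {vspace 'cV['F_2]_n}) : (\dim U <= n)%N.
Proof. by apply: leq_trans (dimvS (subvf U)) _; rewrite dimvf dim_matrix mulr1. Qed.

Lemma mem_ortho_sym (n : nat) (U V : {vspace 'cV['F_2]_n}) :
  (U <= ortho V)%VS = (V <= ortho U)%VS.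
Proof.
wlog suff: U V / (U <= ortho V)%VS -> (V <= ortho U)%VS.
  by move=> h; apply/idP/idP; apply: h.
move=> /subvP UV; apply/subvP => v vV; apply/mem_ortho => u /UV/mem_ortho/(_ v vV).
by under eq_bigr => i _ do rewrite mulrC.
Qed.

(** Over ['F_2] a subspace may meet its orthogonal complement, so the argument is by dimension: [U]
    lies in its double complement, and the two dimensions agree. *)
Lemma orthoK (n : nat) (U : {vspace 'cV['F_2]_n}) : ortho (ortho U) = U.
Proof.
apply/esym/eqP; rewrite eqEdim mem_ortho_sym subvv /= !dim_ortho.
by rewrite subKn ?dim_col_le.
Qed.

(** The parity-check form of the support condition: a linear condition with binary coefficients,
    which makes equally good sense over [L]. *)
Lemma colsp_sub_ker (n m : nat) (W : {vspace 'cV['F_2]_n}) (A : 'M['F_2]_(n, m)) :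
  (colsp A <= W)%VS = (basis_mx (ortho W) *m A == 0).
Proof.
have E j : (col j A \in W) = (basis_mx (ortho W) *m col j A == 0).
  by rewrite -basis_mx_mul orthoK.
apply/colsp_subP/eqP => [AW|XA j]; last first.
  by rewrite E colE mulmxA XA mul0mx.
apply/matrixP => i j; have := AW j; rewrite E colE mulmxA -colE.
by move=> /eqP/colP/(_ i); rewrite !mxE.
Qed.

(** Puts the dimension formula for sums and intersections at the disposal of shortened codes. *)
Lemma shorten_cap (n m : nat) (C : {vspace 'M['F_2]_(n, m)})
    (W : {vspace 'cV['F_2]_n}) : shorten C W = (C :&: shorten fullv W)%VS.
Proof. by apply/vspaceP => A; rewrite memv_cap !mem_shorten memvf. Qed.

Lemma dim_shorten_full (n m : nat) (W : {vspace 'cV['F_2]_n}) :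
  \dim (shorten (fullv : {vspace 'M_(n, m)}) W) = (\dim W * m)%N.
Proof.
rewrite -[in RHS](orthoK W) dim_ortho -(dim_lker_mulmx m (row_free_basis_mx _)).
congr (\dim _); apply/vspaceP => A.
by rewrite mem_shorten memvf memv_ker lfunE /= colsp_sub_ker.
Qed.

(** * Matrices as vectors over the extension field *)

Section Field.

Variables (n m : nat) (L : fieldExtType 'F_2) (b : m.-tuple L).
Hypothesis bP : basis_of fullv b.
Implicit Types (x y : 'cV[L]_n) (A : 'M['F_2]_(n, m)) (W : {vspace 'cV['F_2]_n}).

Definition contract A : 'cV[L]_n := \col_i \sum_(j < m) A i j *: b`_j.

Lemma expandK : cancel (@expand n m L b) contract.
Proof.
move=> x; apply/colP => i; rewrite mxE [RHS](coord_basis bP) ?memvf //.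
by apply: eq_bigr => j _; rewrite mxE.
Qed.

Lemma contractK : cancel contract (@expand n m L b).
Proof.
move=> A; apply/matrixP => i j; rewrite !mxE coord_sum_free //.
exact: basis_free bP.
Qed.

Lemma expandD x y : expand b (x + y) = expand b x + expand b y.
Proof. by apply/matrixP => i j; rewrite !mxE linearD. Qed.

Lemma contractD A A' : contract (A + A') = contract A + contract A'.
Proof. by apply: (can_inj expandK); rewrite expandD !contractK. Qed.

Lemma expand0 : expand b (0 : 'cV[L]_n) = 0.
Proof. by apply/matrixP => i j; rewrite !mxE linear0. Qed.

Lemma contract_eq0 A : (contract A == 0) = (A == 0).
Proof. by rewrite -(can_eq expandK) contractK expand0. Qed.

Lemma supp_contract A : supp b (contract A) = colsp A.
Proof. by rewrite /supp contractK. Qed.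

(** Coordinates are ['F_2]-linear, so a binary matrix acts on the expansion as it acts on the
    vector. *)
Lemma expand_mul (k : nat) (X : 'M['F_2]_(k, n)) x :
  X *m expand b x = \matrix_(i, j) coord b j ((map_mx (in_alg L) X *m x) i 0).
Proof.
apply/matrixP => i j; rewrite !mxE linear_sum /=; apply: eq_bigr => l _.
by rewrite !mxE mulr_algl linearZ.
Qed.

Lemma expand_mul_eq0 (k : nat) (X : 'M['F_2]_(k, n)) x :
  (X *m expand b x == 0) = (map_mx (in_alg L) X *m x == 0).
Proof.
rewrite expand_mul; apply/eqP/eqP => [E|->]; last first.
  by apply/matrixP => i j; rewrite !mxE linear0.
apply/colP => i; rewrite (coord_basis bP (memvf (_ i 0))) big1 ?mxE // => j _.
by move/matrixP/(_ i j): E; rewrite !mxE => ->; rewrite scale0r.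
Qed.

Lemma vshorten_cap (C : {vspace 'cV[L]_n}) W :
  vshorten b C W = (C :&: vshorten b fullv W)%VS.
Proof. by apply/vspaceP => x; rewrite memv_cap !mem_vshorten // memvf. Qed.

(** The vectors with support in [W] are the kernel of the parity-check matrix of [W] read over [L],
    and its rank is unchanged by extending the field. *)
Lemma dim_vshorten_full W :
  \dim (vshorten b (fullv : {vspace 'cV[L]_n}) W) = \dim W.
Proof.
have free' : row_free (map_mx (in_alg L) (basis_mx (ortho W))).
  by rewrite row_free_map row_free_basis_mx.
rewrite -[in RHS](orthoK W) dim_ortho -[RHS]muln1 -(dim_lker_mulmx 1 free').
congr (\dim _); apply/vspaceP => x.
by rewrite mem_vshorten // memvf memv_ker lfunE /= /supp colsp_sub_ker expand_mul_eq0.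
Qed.

End Field.

(** * Reduction to codes *)

(** For positive [m] this says that the two codes have the same rank function, since every [W] is an
    orthogonal complement. *)
Definition same_dims (n m : nat) (L : fieldExtType 'F_2) (b : m.-tuple L)
    (C : {vspace 'M['F_2]_(n, m)}) (C' : {vspace 'cV[L]_n}) : Prop :=
  forall W, \dim (shorten C W) = (m * \dim (vshorten b C' W))%N.

Lemma shortenT (n m : nat) (C : {vspace 'M['F_2]_(n, m)}) :
  shorten C fullv = C.
Proof. by apply/vspaceP => A; rewrite mem_shorten subvf andbT. Qed.

Lemma colsp_subv0 (n m : nat) (A : 'M['F_2]_(n, m)) :
  (colsp A <= 0)%VS = (A == 0).
Proof.
apply/colsp_subP/eqP => [A0|-> j]; last by rewrite linear0 mem0v.
apply/matrixP => i j; have := A0 j; rewrite memv0 => /eqP/colP/(_ i).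
by rewrite !mxE.
Qed.

Lemma shorten0 (n m : nat) (C : {vspace 'M['F_2]_(n, m)}) : shorten C 0 = 0%VS.
Proof.
apply/vspaceP => A; rewrite mem_shorten colsp_subv0 memv0.
by apply: andb_idl => /eqP ->; apply: mem0v.
Qed.

Lemma ortho_full (n : nat) : ortho fullv = 0%VS :> {vspace 'cV['F_2]_n}.
Proof.
by apply/eqP; rewrite -dimv_eq0 dim_ortho dimvf dim_matrix mulr1 subnn.
Qed.

Lemma representation_dim (n m : nat) (M : qmatroid n)
    (C : {vspace 'M['F_2]_(n, m)}) (W : {vspace 'cV['F_2]_n}) :
  (0 < m)%N ->
  (M (ortho W))%:~R = ((\dim C)%:R - (\dim (shorten C W))%:R) / m%:R :> rat ->
  M (ortho W) * m%:Z = (\dim C)%:Z - (\dim (shorten C W))%:Z.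
Proof.
move=> m0 E; have m0' : m%:R != 0 :> rat by rewrite pnatr_eq0 -lt0n.
apply: (@intr_inj rat); rewrite intrM E.
by rewrite intrB -!pmulrn divfK.
Qed.

(** The values of [M] are integers; subtracting the rank formulas for [W] and for [0], where the
    shortened code vanishes, exhibits [dim C(W)] as a multiple of [m]. *)
Lemma representation_dvd (n m : nat) (M : qmatroid n)
    (C : {vspace 'M['F_2]_(n, m)}) :
  (0 < m)%N ->
  (forall U, (M U)%:~R =
    ((\dim C)%:R - (\dim (shorten C (ortho U)))%:R) / m%:R :> rat) ->
  forall W, (m %| \dim (shorten C W))%N.
Proof.
move=> m0 hM W.
have key W' : M (ortho W') * m%:Z = (\dim C)%:Z - (\dim (shorten C W'))%:Z.
  by apply: representation_dim => //; rewrite hM orthoK.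
have := key W; have := key 0%VS; rewrite shorten0 dimv0 subr0 => <- E.
have -> : \dim (shorten C W) = `|((M (ortho 0) - M (ortho W)) * m%:Z)%R|%N.
  by rewrite mulrBl E opprB addrC subrK absz_nat.
by rewrite abszM dvdn_mull.
Qed.

Lemma same_dims_representable (n m : nat) (L : fieldExtType 'F_2)
    (b : m.-tuple L) (M : qmatroid n) (C : {vspace 'M['F_2]_(n, m)})
    (C' : {vspace 'cV[L]_n}) :
  (0 < m)%N -> basis_of fullv b ->
  (forall U, (M U)%:~R =
    ((\dim C)%:R - (\dim (shorten C (ortho U)))%:R) / m%:R :> rat) ->
  same_dims b C C' -> field_representable b M.
Proof.
move=> m0 bP hM CC'; exists C' => W.
have m0' : m%:R != 0 :> rat by rewrite pnatr_eq0 -lt0n.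
have vT : vshorten b C' fullv = C'.
  by apply/vspaceP => x; rewrite mem_vshorten // subvf andbT.
apply: (@intr_inj rat); rewrite hM -[in \dim C](shortenT C) !CC' vT.
by rewrite intrB -!pmulrn !natrM -mulrBr mulrC mulKf.
Qed.

(** * Codes that are zero, full, of dimension m or of codimension m *)

Section Cases.

Variables (n m : nat) (L : fieldExtType 'F_2) (b : m.-tuple L).
Hypotheses (m_gt0 : (0 < m)%N) (bP : basis_of fullv b).
Implicit Types (x y : 'cV[L]_n) (A B : 'M['F_2]_(n, m)).
Implicit Types (W V : {vspace 'cV['F_2]_n}).

Variable C : {vspace 'M['F_2]_(n, m)}.
Hypothesis dvdC : forall W, (m %| \dim (shorten C W))%N.

Lemma shorten_subv W : (shorten C W <= C)%VS.
Proof. by apply/subvP => A; rewrite mem_shorten => /andP[]. Qed.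

(** The only multiple of [m] strictly between [0] and [2m] is [m]; this is how divisibility is used
    most of the time. *)
Lemma dim_shorten_lt2m W :
  (\dim (shorten C W) < m.*2)%N -> shorten C W != 0%VS -> \dim (shorten C W) = m.
Proof.
rewrite -dimv_eq0; have /dvdnP[k ->] := dvdC W.
by rewrite -mul2n ltn_pmul2r //; case: k => [|[|]] //; rewrite mul1n.
Qed.

Lemma same_dims0 : \dim C = 0%N -> same_dims b C 0.
Proof.
move=> /eqP; rewrite dimv_eq0 => /eqP C0 W.
have -> : shorten C W = 0%VS.
  by apply/eqP; rewrite -subv0 -C0 shorten_subv.
have -> : vshorten b (0 : {vspace 'cV[L]_n}) W = 0%VS.
  by apply/eqP; rewrite -subv0; apply/subvP => x; rewrite mem_vshorten // => /andP[].
by rewrite !dimv0 muln0.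
Qed.

Lemma same_dims_full : \dim C = (n * m)%N -> same_dims b C fullv.
Proof.
move=> dC W; have -> : C = fullv.
  apply/eqP; rewrite eqEdim subvf dC dimvf dim_matrix; exact: leqnn.
by rewrite dim_shorten_full dim_vshorten_full // mulnC.
Qed.

Lemma mem_vshorten_contract (C' : {vspace 'cV[L]_n}) W A :
  (contract b A \in vshorten b C' W) = (contract b A \in C') && (colsp A <= W)%VS.
Proof. by rewrite mem_vshorten // supp_contract. Qed.

(* The vectors with support in [W] form an [L]-space. *)
Lemma supp_scale (k : L) x W :
  k != 0 -> (supp b (k *: x) <= W)%VS = (supp b x <= W)%VS.
Proof.
move=> k0; have E z : (supp b z <= W)%VS = (z \in vshorten b fullv W).
  by rewrite mem_vshorten // memvf.
by rewrite !E; apply/idP/idP => [/(memvZ k^-1)|]; [rewrite scalerK | apply: memvZ].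
Qed.

Lemma same_dims1 A : \dim C = m -> A \in C -> A != 0 ->
  same_dims b C <[contract b A]>.
Proof.
move=> dC AC A0 W; set a := contract b A.
have a0 : a != 0 by rewrite contract_eq0.
have lt2 : (\dim (shorten C W) < m.*2)%N.
  by apply: leq_ltn_trans (dimvS (shorten_subv W)) _; rewrite dC -addnn; lia.
have [AW|nAW] := boolP (colsp A <= W)%VS.
  rewrite dim_shorten_lt2m //; last first.
    apply: contra A0 => /eqP S0; rewrite -memv0 -S0 mem_shorten AC.
    exact: AW.
  suff -> : vshorten b <[a]> W = <[a]>%VS by rewrite dim_vline a0 muln1.
  apply/vspaceP => x; rewrite mem_vshorten //; apply: andb_idr.
  case/vlineP => k ->; have [->|k0] := eqVneq k 0.
    by rewrite scale0r /supp expand0 (subv_trans _ (sub0v W)) // colsp_subv0.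
  by rewrite supp_scale // supp_contract.
have [->|S0] := eqVneq (shorten C W) 0%VS.
  suff -> : vshorten b <[a]> W = 0%VS by rewrite !dimv0 muln0.
  apply/vspaceP => x; rewrite mem_vshorten // memv0.
  apply/andP/eqP => [[/vlineP[k ->]]|->]; last first.
    by rewrite mem0v /supp expand0 (subv_trans _ (sub0v W)) // colsp_subv0.
  have [->|k0] := eqVneq k 0; first by rewrite scale0r.
  by rewrite supp_scale // supp_contract // (negPf nAW).
(* A nonzero [C(W)] has dimension [m], so it is all of [C] and contains [A], against [nAW]. *)
have /eqP E : shorten C W == C.
  by rewrite eqEdim shorten_subv dC dim_shorten_lt2m /=.
by move: AC nAW; rewrite -{1}E mem_shorten => /andP[_ ->].
Qed.

(** The complementary projection [1 - projv C] kills [C] but not [A]; a nonzero entry of its value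
    at [A] is the functional sought, and [B] lists its values at the matrix units. *)
Lemma separating_functional A : A \notin C ->
  exists B, (forall A', A' \in C -> \sum_i \sum_j B i j * A' i j = 0) /\
            \sum_i \sum_j B i j * A i j != 0.
Proof.
move=> AC; pose f : 'End('M['F_2]_(n, m)) := (\1 - projv C)%VF.
have fA : f A != 0.
  rewrite lfunE /= !lfunE /= subr_eq0; apply: contra AC => /eqP ->.
  exact: memv_proj.
have [i0 [j0 fij]] : exists i, exists j, f A i j != 0.
  have /existsP[i /existsP[j ij]] : [exists i, exists j, f A i j != 0].
    apply: contraR fA; rewrite negb_exists => /forallP fA0.
    apply/eqP/matrixP => i j; rewrite mxE; apply/eqP; move: (fA0 i).
    by rewrite negb_exists => /forallP/(_ j); rewrite negbK.
  by exists i, j.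
pose B : 'M['F_2]_(n, m) := \matrix_(i, j) f (delta_mx i j) i0 j0.
exists B; have E (Y : 'M['F_2]_(n, m)) : \sum_i \sum_j B i j * Y i j = f Y i0 j0.
  rewrite [in RHS](matrix_sum_delta Y) linear_sum summxE /=.
  apply: eq_bigr => i _; rewrite linear_sum summxE; apply: eq_bigr => j _.
  by rewrite linearZ !mxE mulrC.
split=> [A' A'C|]; rewrite E // !lfunE /= !lfunE /= projv_id //.
by rewrite subrr mxE.
Qed.

Lemma vshorten_cap_sub (C' : {vspace 'cV[L]_n}) W W0 :
  (C' <= vshorten b fullv W0)%VS ->
  vshorten b C' W = vshorten b C' (W :&: W0)%VS.
Proof.
move=> /subvP CW0; apply/vspaceP => x; rewrite !mem_vshorten // subv_cap.
apply: andb_id2l => /CW0; rewrite mem_vshorten // memvf /= => ->.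
by rewrite andbT.
Qed.

Lemma shorten_cap_sub W W0 :
  (C <= shorten fullv W0)%VS -> shorten C W = shorten C (W :&: W0)%VS.
Proof.
move=> /subvP CW0; apply/vspaceP => A; rewrite !mem_shorten // subv_cap.
apply: andb_id2l => /CW0; rewrite mem_shorten // memvf /= => ->.
by rewrite andbT.
Qed.

Lemma shorten_fullS V W :
  (V <= W)%VS -> (shorten (fullv : {vspace 'M_(n, m)}) V <= shorten fullv W)%VS.
Proof.
move=> VW; apply/subvP => A; rewrite !mem_shorten => /andP[-> /=].
by move/subv_trans; apply.
Qed.

Lemma dim_shorten_le W : (\dim (shorten C W) <= \dim W * m)%N.
Proof. by rewrite -dim_shorten_full dimvS // shorten_cap capvSr. Qed.

Lemma dim_shorten_ge V W :
  (C <= shorten fullv V)%VS -> (W <= V)%VS ->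
  (\dim C + \dim W * m <= \dim (shorten C W) + \dim V * m)%N.
Proof.
move=> CV WV; rewrite shorten_cap -!(dim_shorten_full m) -(dimv_sum_cap C).
by rewrite addnC leq_add2l dimvS // subv_add CV shorten_fullS.
Qed.

Definition lift_col (w : 'cV['F_2]_n) : 'cV[L]_n := map_mx (in_alg L) w.

Lemma supp_lift_col w W : w \in W -> (supp b (lift_col w) <= W)%VS.
Proof.
move=> wW; apply/colsp_subP => j.
suff -> : col j (expand b (lift_col w)) = coord b j 1 *: w by rewrite memvZ.
by apply/colP => i; rewrite !mxE linearZ /= mulrC.
Qed.

(** For [W] inside [W0], each shortened code is either everything supported in [W] or loses exactly
    one unit ([m] over ['F_2], one over [L]). The point is that both codes are in the same case. *)
Lemma same_dims_corank1 (W0 : {vspace 'cV['F_2]_n}) :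
  (C <= shorten fullv W0)%VS -> (\dim C + m = \dim W0 * m)%N ->
  exists C', same_dims b C C'.
Proof.
move=> CW0 dC.
have [A AW0 AC] : exists2 A, A \in shorten fullv W0 & A \notin C.
  apply/subvPn; apply/negP => /dimvS; rewrite dim_shorten_full -dC.
  by rewrite -{2}[\dim C]addn0 leq_add2l leqNgt m_gt0.
have [B [BC BA]] := separating_functional AC.
have [a aE] : exists a : 'cV[L]_n, forall i, a i 0 = \sum_k B i k *: b`_k.
  by exists (contract b B) => i; rewrite mxE.
pose f := linfun (mulmx a^T : 'cV[L]_n -> 'M_(1, 1)).
have fE x : (x \in lker f) = (\sum_i a i 0 * x i 0 == 0).
  rewrite memv_ker lfunE /=; apply/eqP/eqP => [/matrixP/(_ 0 0)|uv0].
    by rewrite !mxE => uv0; rewrite -[RHS]uv0; apply: eq_bigr => i _; rewrite mxE.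
  apply/matrixP=> i j; rewrite !ord1 !mxE -[RHS]uv0.
  by apply: eq_bigr => k _; rewrite mxE.
have le1 (X : {vspace 'M[L]_(1, 1)}) : (\dim X <= 1)%N.
  by apply: leq_trans (dimvS (subvf X)) _; rewrite dimvf dim_matrix.
pose C' := (vshorten b fullv W0 :&: lker f)%VS.
exists C' => W; rewrite (shorten_cap_sub _ CW0).
rewrite (@vshorten_cap_sub C' W W0) ?capvSl //.
(* Both codes are supported in [W0], so [W] may be replaced by its intersection with [W0]. *)
move: (W :&: W0)%VS (capvSr W W0) => {}W WW0.
have C'W : vshorten b C' W = (vshorten b fullv W :&: lker f)%VS.
  apply/vspaceP => x; rewrite !(mem_vshorten, memv_cap) // memvf /= -andbA.
  apply/and3P/andP => [[_ -> ->] //|[xW ->]]; split=> //.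
  exact: subv_trans xW WW0.
have Cge := dim_shorten_ge CW0 WW0; have Cle := dim_shorten_le W.
have fdim := limg_ker_dim f (vshorten b fullv W).
rewrite -C'W dim_vshorten_full // in fdim.
have [TC|nTC] := boolP (shorten fullv W <= C)%VS.
  have Tf : (vshorten b fullv W <= lker f)%VS.
    apply/subvP => x; rewrite mem_vshorten // memvf /= fE => /colsp_subP xW.
    under eq_bigr => i _ do rewrite (coord_basis bP (memvf (x i 0))) aE mulr_sumr.
    rewrite exchange_big big1 //= => j _.
    under eq_bigr => i _ do rewrite mulr_suml.
    rewrite exchange_big big1 //= => k _.
    under eq_bigr => i _ do rewrite -scalerAr -scalerAl scalerA mulrC.
    rewrite -scaler_suml.
    (* This matrix has column [j] of [expand b x] in position [k] and zeros elsewhere. The value of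
       [B] on it is the coefficient of [b_j b_k] in the product [a.x]. *)
    have : col j (expand b x) *m delta_mx 0 k \in C.
      apply: (subvP TC); rewrite mem_shorten memvf /=; apply/colsp_subP => l.
      suff -> : col l (col j (expand b x) *m delta_mx 0 k) =
        (l == k)%:R *: col j (expand b x) by rewrite memvZ.
      by apply/colP => i; rewrite !mxE big_ord1 !mxE eqxx /= mulrC.
    move/BC => E; rewrite [X in X *: _](_ : _ = 0) ?scale0r //.
    rewrite -[RHS]E; apply: eq_bigr => i _.
    rewrite (bigD1 k) //= big1 => [|l lk]; rewrite !mxE big_ord1 !mxE.
      by rewrite !eqxx mulr1 addr0 mulrC.
    by rewrite (negPf lk) andbF !mulr0.
  have -> : shorten C W = shorten fullv W.
    by rewrite shorten_cap; apply/capv_idPr.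
  by rewrite C'W (capv_idPl Tf) dim_shorten_full dim_vshorten_full // mulnC.
have nTf : ~~ (vshorten b fullv W <= lker f)%VS.
  apply: contra nTC => Tf.
  (* Conversely, the columns of [Y] are lifted to vectors over [L] supported in [W]; coordinate [j]
     of their product with [a] is the contribution of column [j] to the value of [B] at [Y]. *)
  have BT Y : Y \in shorten fullv W -> \sum_i \sum_j B i j * Y i j = 0.
    rewrite mem_shorten memvf => /colsp_subP YW.
    rewrite exchange_big big1 //= => j _.
    have : lift_col (col j Y) \in lker f.
      by apply: (subvP Tf); rewrite mem_vshorten // memvf supp_lift_col.
    rewrite fE => /eqP /(congr1 (coord b j)); rewrite linear0 => E.
    rewrite -[RHS]E linear_sum /=; apply: eq_bigr => i _; rewrite aE !mxE.
    rewrite mulr_algr linearZ /= coord_sum_free ?(basis_free bP) //.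
    by rewrite mulrC.
  apply: contraR BA => nTC.
  (* By divisibility a proper [C(W)] misses at least [m] dimensions, which is the codimension of
     [C]. So the sum fills the space, and [B] would vanish at [A] too. *)
  have /eqP E : (C + shorten fullv W == shorten fullv W0)%VS.
    rewrite eqEdim subv_add CW0 shorten_fullS //=.
    have := dimv_sum_cap C (shorten fullv W).
    rewrite -shorten_cap !dim_shorten_full => E.
    have : (\dim (shorten C W) < \dim W * m)%N.
      rewrite ltn_neqAle Cle andbT; apply: contra nTC => /eqP E'.
      apply/capv_idPr/eqP; rewrite eqEdim capvSr -shorten_cap E' /=.
      by rewrite dim_shorten_full.
    have /dvdnP[k Ek] := dvdC W; rewrite Ek ltn_pmul2r // => kW.
    have : (k.+1 * m <= \dim W * m)%N by rewrite leq_pmul2r.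
    rewrite mulSn; lia.
  move: AW0; rewrite -E => /memv_addP[A1 /BC E1 [A2 /BT E2 ->]].
  apply/eqP; rewrite -[RHS](addr0 0) -[X in _ = X + _]E1 -[X in _ = _ + X]E2.
  rewrite -big_split; apply: eq_bigr => i _ /=.
  by rewrite -big_split; apply: eq_bigr => j _; rewrite mxE mulrDr.
have lt1 : (\dim (vshorten b C' W) < \dim W)%N.
  rewrite ltn_neqAle andbC -{1}fdim leq_addr /=; apply: contra nTf => /eqP E.
  apply/capv_idPl/eqP; rewrite eqEdim capvSl -C'W E /=.
  by rewrite dim_vshorten_full.
have lt2 : (\dim (shorten C W) < \dim W * m)%N.
  rewrite ltn_neqAle Cle andbT; apply: contra nTC => /eqP E'.
  apply/capv_idPr/eqP; rewrite eqEdim capvSr -shorten_cap E' /=.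
  by rewrite dim_shorten_full.
(* Both dimensions are squeezed: less than full, but short of it by at most one unit. *)
have := le1 (f @: vshorten b fullv W)%VS.
have /dvdnP[k Ek] := dvdC W; rewrite Ek ltn_pmul2r // in lt2 *.
have : (\dim W * m <= k.+1 * m)%N by rewrite mulSn; lia.
rewrite leq_pmul2r // => l1 l2; rewrite mulnC.
congr (_ * _)%N; apply/eqP; rewrite eqn_leq; apply/andP; split.
  by rewrite -ltnS (leq_trans lt2) // -fdim -[X in (_ <= X)%N]addn1 leq_add2l.
by rewrite -ltnS (leq_trans lt1).
Qed.

End Cases.

(** * Codes of dimension 2m in dimension 4 *)

Lemma dim_plane (F : fieldType) (vT : vectType F) (x y : vT) :
  x != 0 -> y \notin <[x]>%VS -> \dim (<[x]> + <[y]>) = 2%N.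
Proof.
move=> x0 yx; have y0 : y != 0 by apply: contra yx => /eqP ->; apply: mem0v.
rewrite dimv_disjoint_sum ?dim_vline ?x0 ?y0 //.
apply/eqP; rewrite -subv0; apply/subvP => z; rewrite memv_cap memv0.
case/andP => zx /vlineP[k zE]; move: zx; rewrite zE.
have [->|k0] := eqVneq k 0; first by rewrite scale0r.
by move=> /(memvZ k^-1); rewrite scalerK // (negPf yx).
Qed.

Lemma dim_colsp_le (n m : nat) (A : 'M['F_2]_(n, m)) : (\dim (colsp A) <= m)%N.
Proof. by apply: leq_trans (dim_span _) _; rewrite size_map size_enum_ord. Qed.

Section RankTwo.

Variables (m : nat) (L : fieldExtType 'F_2) (b : m.-tuple L).
Hypotheses (m_gt0 : (0 < m)%N) (bP : basis_of fullv b).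
Implicit Types (x y : 'cV[L]_4) (A B : 'M['F_2]_(4, m)).
Implicit Types (W V : {vspace 'cV['F_2]_4}).

Variable C : {vspace 'M['F_2]_(4, m)}.
Hypothesis dvdC : forall W, (m %| \dim (shorten C W))%N.
Hypothesis dimC : \dim C = m.*2.
Hypothesis nondegC : forall W, W != fullv -> ~~ (C <= shorten fullv W)%VS.

Lemma dim_shorten_proper W : W != fullv -> (\dim (shorten C W) < m.*2)%N.
Proof.
move=> /nondegC nC; rewrite ltnNge -dimC; apply: contra nC => dW.
apply/capv_idPl/eqP; rewrite -shorten_cap eqEdim dW andbT.
exact: shorten_subv.
Qed.

Lemma dim4 : \dim (fullv : {vspace 'cV['F_2]_4}) = 4%N.
Proof. by rewrite dimvf dim_matrix. Qed.

Lemma dim_lt4 W : W != fullv -> (\dim W <= 3)%N.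
Proof.
move=> Wf; rewrite -ltnS -[X in (_ < X)%N]dim4 ltnNge; apply: contra Wf => dW.
by rewrite eqEdim subvf.
Qed.

(** For proper [W] the dimensions are [0] or [m] on one side and [0] or [1] on the other. On
    hyperplanes both are nonzero by the dimension formula, so only the vanishing in dimension at
    most 2 has to be compared. *)
Lemma same_dims_rank2 (C' : {vspace 'cV[L]_4}) :
  \dim C' = 2%N ->
  (forall W, W != fullv -> ~~ (C' <= vshorten b fullv W)%VS) ->
  (forall W, (\dim W <= 2)%N -> (shorten C W == 0%VS) = (vshorten b C' W == 0%VS)) ->
  same_dims b C C'.
Proof.
move=> dC' nC' h W.
have [->|Wf] := eqVneq W fullv.
  rewrite shortenT; suff -> : vshorten b C' fullv = C' by rewrite dC' dimC muln2.
  by apply/vspaceP => x; rewrite mem_vshorten // subvf andbT.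
have C'le : (\dim (vshorten b C' W) <= 1)%N.
  rewrite -ltnS -[X in (_ < X)%N]dC' ltnNge; apply: contra (nC' _ Wf) => dW.
  by apply/capv_idPl/eqP; rewrite -vshorten_cap // eqEdim dW andbT vshorten_cap // capvSl.
have dCW := dim_shorten_lt2m m_gt0 dvdC (dim_shorten_proper Wf).
have /predU1P[W3|W2] : (\dim W == 3)%N || (\dim W <= 2)%N.
- by have := dim_lt4 Wf; rewrite leq_eqVlt.
- have /dCW -> : shorten C W != 0%VS.
    rewrite -dimv_eq0; have := dim_shorten_ge (W := W) (V := fullv) (C := C).
    rewrite shortenT subvf subvf dim4 W3 dimC => /(_ isT isT).
    by case: (\dim (shorten C W)) => //; lia.
  suff -> : \dim (vshorten b C' W) = 1%N by rewrite muln1.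
  apply/eqP; rewrite eqn_leq C'le /=.
  have := dimv_sum_cap C' (vshorten b fullv W).
  rewrite -vshorten_cap // dC' dim_vshorten_full // W3.
  have : (\dim (C' + vshorten b fullv W) <= 4)%N.
    by apply: leq_trans (dimvS (subvf _)) _; rewrite dimvf dim_matrix.
  by case: (\dim (vshorten b C' W)) => //; rewrite addn0 => /[swap] ->.
have := h _ W2; have [->|CW] := eqVneq (shorten C W) 0%VS.
  by move=> /esym/eqP ->; rewrite !dimv0 muln0.
move=> /esym/negbT; rewrite -dimv_eq0 dCW // => C'W.
suff -> : \dim (vshorten b C' W) = 1%N by rewrite muln1.
by apply/eqP; rewrite eqn_leq C'le lt0n.
Qed.

(** Some coordinate of [1] is nonzero, so [w] itself is among the columns up to a nonzero scalar. *)
Lemma mem_supp_lift_col (w : 'cV['F_2]_4) W :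
  (supp b (lift_col L w) <= W)%VS = (w \in W).
Proof.
apply/idP/idP => [/colsp_subP wW|]; last exact: supp_lift_col.
have E j : col j (expand b (lift_col L w)) = coord b j 1 *: w.
  by apply/colP => i; rewrite !mxE linearZ /= mulrC.
have [j j0] : exists j, coord b j 1 != 0.
  apply/existsP; apply: contraT; rewrite negb_exists => /forallP b0.
  have := oner_neq0 L; rewrite (coord_basis bP (memvf 1)) big1 ?eqxx // => j _.
  by have := b0 j; rewrite negbK => /eqP ->; rewrite scale0r.
by have := wW j; rewrite E => /(memvZ (coord b j 1)^-1); rewrite scalerK.
Qed.

(** If [W] contains [w], both shortened codes are nonzero. Otherwise both vanish, because [W +
    <[w]>] is still proper and the column space of [A] lies in no proper subspace containing [w]. *)
Lemma same_dims_point (w : 'cV['F_2]_4) :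
  w != 0 -> (shorten fullv <[w]> <= C)%VS -> exists C', same_dims b C C'.
Proof.
move=> w0 TC; set T := shorten fullv <[w]> in TC.
have dT : \dim T = m by rewrite /T dim_shorten_full dim_vline w0 mul1n.
have [A AC AT] : exists2 A, A \in C & A \notin T.
  by apply/subvPn; apply/negP => /dimvS; rewrite dimC dT; lia.
have TV V : w \in V -> (T <= shorten C V)%VS.
  move=> wV; rewrite shorten_cap subv_cap TC.
  by rewrite shorten_fullS // -memvE.
(* Otherwise [C(V)] would contain both [T] and [A], so its dimension would exceed [m], while [V] is
   proper. *)
have key V : V != fullv -> w \in V -> ~~ (colsp A <= V)%VS.
  move=> Vf wV; apply/negP => AV.
  have AV' : A \in shorten C V by rewrite mem_shorten AC.
  have lt : (m < \dim (shorten C V))%N.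
    rewrite -[X in (X < _)%N]dT ltn_neqAle dimvS ?TV // andbT; apply: contra AT => /eqP E.
    suff /eqP -> : T == shorten C V by [].
    by rewrite eqEdim TV // E /=.
  move: (lt); rewrite (dim_shorten_lt2m m_gt0 dvdC (dim_shorten_proper Vf)) ?ltnn //.
  by rewrite -dimv_eq0 -lt0n; apply: leq_ltn_trans lt.
pose a := contract b A; pose w' := lift_col L w.
have aE : supp b a = colsp A by rewrite supp_contract.
have w'E V : (supp b w' <= V)%VS = (w \in V) by rewrite mem_supp_lift_col.
have w'0 : w' != 0.
  apply: contra w0 => /eqP E; rewrite -memv0 -w'E E /supp expand0.
  by rewrite colsp_subv0.
have ww : <[w]>%VS != fullv.
  by apply/eqP => E; have := dim4; rewrite -E dim_vline w0.
have memE V x : (supp b x <= V)%VS = (x \in vshorten b fullv V).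
  by rewrite mem_vshorten // memvf.
exists (<[w']> + <[a]>)%VS; apply: same_dims_rank2.
- apply: dim_plane => //; apply: contra (key _ ww (memv_line w)) => aw.
  rewrite -aE memE; apply: subvP aw; rewrite -memvE -memE w'E.
  exact: memv_line.
- move=> W Wf; rewrite subv_add -!memvE -!memE w'E aE.
  by apply/negP => /andP[wW]; apply/negP/key.
move=> W W2; have [wW|wW] := boolP (w \in W).
  transitivity false.
    apply/negP => /eqP E; have := TV _ wW; rewrite E subv0 -dimv_eq0 dT.
    by rewrite eqn0Ngt m_gt0.
  apply/esym/negP => /eqP E; have : w' \in vshorten b (<[w']> + <[a]>) W.
    by rewrite mem_vshorten // w'E wW (subvP (addvSl _ _)) ?memv_line.
  by rewrite E memv0 (negPf w'0).
have Wwf : (W + <[w]>)%VS != fullv.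
  apply/eqP => E; have := dim4; rewrite -E => dE.
  have := dimv_add_leqif W <[w]>; rewrite dE dim_vline w0 => -[] le _.
  by have := leq_trans le (leq_add W2 (leqnn _)).
have wWw : w \in (W + <[w]>)%VS by rewrite (subvP (addvSr _ _)) ?memv_line.
transitivity true; last apply/esym.
  apply/negPn/negP => CW0.
  have Wf : W != fullv by apply: contra wW => /eqP ->; rewrite memvf.
  have dCW := dim_shorten_lt2m m_gt0 dvdC (dim_shorten_proper Wf) CW0.
  have TCW : (T :&: shorten C W)%VS = 0%VS.
    apply/eqP; rewrite -subv0; apply/subvP => X.
    rewrite memv_cap !mem_shorten memvf /= memv0 => /andP[Xw /andP[_ XW]].
    rewrite -colsp_subv0; suff <- : (<[w]> :&: W)%VS = 0%VS by rewrite subv_cap Xw.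
    apply/eqP; rewrite -subv0; apply/subvP => z.
    rewrite memv_cap memv0 => /andP[/vlineP[k ->]].
    have [->|k0] := eqVneq k 0; first by rewrite scale0r.
    by move=> /(memvZ k^-1); rewrite scalerK // (negPf wW).
  (* A nonzero [C(W)] has dimension [m] and meets [T] trivially. Together they span [C], which then
     lies in the proper subspace [W + <[w]>]. *)
  have := nondegC Wwf; suff -> : C = (T + shorten C W)%VS.
    rewrite subv_add shorten_fullS ?addvSr //= shorten_cap.
    by rewrite (subv_trans (capvSr _ _)) // shorten_fullS // addvSl.
  apply/esym/eqP; rewrite eqEdim subv_add TC shorten_subv /=.
  by rewrite dimv_disjoint_sum // dimC dT dCW addnn.
rewrite -subv0; apply/subvP => x; rewrite mem_vshorten // memv0.
case/andP => /memv_addP[_ /vlineP[k ->] [_ /vlineP[l ->] ->]].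
have [->|l0] := eqVneq l 0.
  rewrite scale0r addr0; have [->|k0] := eqVneq k 0; first by rewrite scale0r.
  by rewrite supp_scale // w'E (negPf wW).
(* With [l] nonzero, [l *: a] differs from a vector supported in [W] by a multiple of [w'], which
   puts the support of [a] inside [W + <[w]>]. *)
move=> xW; case/negP: (key _ Wwf wWw); rewrite -aE -(supp_scale bP a _ l0) memE.
rewrite -[_ *: a](addKr (k *: w')) memvD //.
  by rewrite rpredN memvZ // -memE w'E.
by rewrite -memE (subv_trans xW) // addvSl.
Qed.

Hypothesis no_point : forall w, w != 0 -> ~~ (shorten fullv <[w]> <= C)%VS.

(** A nonzero word with columns on [<[w]>] makes [C(<[w]>)] of dimension [m], hence equal to the
    space of all matrices on that line, against [no_point]. *)
Lemma dim_colsp_ge2 A : A \in C -> A != 0 -> (2 <= \dim (colsp A))%N.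
Proof.
move=> AC A0; rewrite ltnNge; apply/negP => dA.
have [w w0 Aw] : exists2 w, w != 0 & (colsp A <= <[w]>)%VS.
  exists (vpick (colsp A)); first by rewrite vpick0 -subv0 colsp_subv0.
  suff /eqP -> : <[vpick (colsp A)]>%VS == colsp A by apply: subvv.
  rewrite eqEdim -memvE memv_pick dim_vline vpick0.
  by rewrite -subv0 colsp_subv0 A0 /=; apply: dA.
have Cw0 : shorten C <[w]> != 0%VS.
  by apply: contra A0 => /eqP Cw; rewrite -memv0 -Cw mem_shorten AC.
have dT : \dim (shorten (fullv : {vspace 'M['F_2]_(4, m)}) <[w]>) = m.
  by rewrite dim_shorten_full dim_vline w0 mul1n.
have wf : <[w]>%VS != fullv.
  by apply/eqP => E; have := dim4; rewrite -E dim_vline w0.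
have dCw := dim_shorten_lt2m m_gt0 dvdC (dim_shorten_proper wf) Cw0.
case/negP: (no_point w0); apply/capv_idPr/eqP.
by rewrite -shorten_cap eqEdim dT dCw leqnn andbT shorten_cap capvSr.
Qed.

Lemma colsp_rank2 A W : A \in C -> A != 0 -> (\dim W <= 2)%N ->
  (colsp A <= W)%VS -> colsp A = W.
Proof.
move=> AC A0 W2 AW; apply/eqP; rewrite eqEdim AW (leq_trans W2) //.
exact: dim_colsp_ge2.
Qed.

Lemma dim_shorten_colsp A : A \in C -> A != 0 -> colsp A != fullv ->
  \dim (shorten C (colsp A)) = m.
Proof.
move=> AC A0 Af; apply: dim_shorten_lt2m => //; first exact: dim_shorten_proper.
apply: contra A0 => /eqP CA; rewrite -memv0 -CA mem_shorten AC; exact: subvv.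
Qed.

Lemma dim2_proper W : \dim W = 2%N -> W != fullv.
Proof. by move=> W2; apply/eqP => E; have := dim4; rewrite -E W2. Qed.

(** A common nonzero word has rank at least 2, so its column space is that of [B], which would then
    lie in that of [A]. *)
Lemma shorten_colsp_disjoint A B : A \in C -> B \in C ->
  \dim (colsp A) = 2%N -> \dim (colsp B) = 2%N -> B \notin shorten C (colsp A) ->
  (shorten C (colsp A) :&: shorten C (colsp B) = 0)%VS.
Proof.
move=> AC BC dA dB BA; apply/eqP; rewrite -subv0; apply/subvP => X.
rewrite memv_cap !mem_shorten memv0 => /andP[/andP[XC XA] /andP[_ XB]].
apply: contraR BA => X0; rewrite mem_shorten BC.
by rewrite -(colsp_rank2 XC X0 _ XB) ?dB //= XA.
Qed.

Lemma shorten_colsp_sum A B : A \in C -> B \in C ->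
  \dim (colsp A) = 2%N -> \dim (colsp B) = 2%N -> B \notin shorten C (colsp A) ->
  (shorten C (colsp A) + shorten C (colsp B))%VS = C.
Proof.
move=> AC BC dA dB BA; apply/eqP; rewrite eqEdim subv_add !shorten_subv /=.
have n0 X : \dim (colsp X) = 2%N -> X != 0.
  move=> dX; apply/eqP => X0; have := colsp_subv0 X; rewrite X0 eqxx subv0.
  by rewrite -X0 -dimv_eq0 dX.
rewrite dimv_disjoint_sum ?shorten_colsp_disjoint // dimC.
by rewrite !dim_shorten_colsp ?n0 ?dim2_proper // addnn.
Qed.

Lemma colsp_add_full A B : A \in C -> B \in C ->
  \dim (colsp A) = 2%N -> \dim (colsp B) = 2%N -> B \notin shorten C (colsp A) ->
  (colsp A + colsp B)%VS = fullv.
Proof.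
move=> AC BC dA dB BA; apply/eqP; rewrite -[_ == _]negbK; apply/negP => /nondegC.
rewrite -{1}(shorten_colsp_sum AC BC dA dB BA) subv_add.
rewrite !(shorten_cap C) !(subv_trans (capvSr _ _)) //.
  by rewrite shorten_fullS ?addvSr.
by rewrite shorten_fullS ?addvSl.
Qed.

(** The column spaces of [A] and [B] span everything, so the candidate [C'] lies in no proper
    subspace either. *)
Lemma same_dims_span2 A B : A \in C -> B \in C ->
  \dim (colsp A) = 2%N -> \dim (colsp B) = 2%N -> B \notin shorten C (colsp A) ->
  let C' := (<[contract b A]> + <[contract b B]>)%VS in
  (forall W, (\dim W <= 2)%N -> (shorten C W == 0%VS) = (vshorten b C' W == 0%VS)) ->
  same_dims b C C'.
Proof.
move=> AC BC dA dB BA C' h; apply: same_dims_rank2 => //.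
  apply: dim_plane.
    rewrite contract_eq0 //; apply/eqP => A0; have := colsp_subv0 A.
    by rewrite A0 eqxx subv0 -A0 -dimv_eq0 dA.
  apply: contra BA => BA; rewrite mem_shorten BC -(supp_contract bP).
  suff : contract b B \in vshorten b fullv (colsp A).
    by rewrite mem_vshorten // memvf.
  apply: subvP BA.
  by rewrite -memvE mem_vshorten // memvf supp_contract //= subvv.
move=> W; apply: contra; rewrite subv_add -!memvE !mem_vshorten // !memvf /=.
rewrite !supp_contract // -subv_add (colsp_add_full AC BC dA dB BA) => fW.
by apply/eqP/vspaceP => x; rewrite memvf (subvP fW) ?memvf.
Qed.

End RankTwo.

(** * Two columns *)

(** Serves for scalars as well as column indices, since ['F_2] is convertible to ['I_2]. *)
Lemma ord2P (j : 'I_2) : {j = 0} + {j = 1}.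
Proof. by case: j => [[|[|//]] p]; [left | right]; apply: val_inj. Qed.

Lemma addF2 (V : lmodType 'F_2) (v : V) : v + v = 0.
Proof.
rewrite -[v]scale1r -scalerDl; suff -> : 1 + 1 = 0 :> 'F_2 by rewrite scale0r.
exact: val_inj.
Qed.

Lemma contractZ (n m : nat) (L : fieldExtType 'F_2) (b : m.-tuple L) (c : 'F_2)
    (A : 'M['F_2]_(n, m)) : contract b (c *: A) = c%:A *: contract b A.
Proof.
apply/colP => i; rewrite !mxE mulr_algl scaler_sumr; apply: eq_bigr => j _.
by rewrite mxE scalerA.
Qed.

(** The quotient [t] of the two basis elements satisfies [t^2 = t + 1]. Expanding [b_1^2 / b_0] in
    the basis leaves four binary quadratics; the other three force [b_1 = 0] or [b_1 = b_0]. *)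
Lemma F4_sqr (L : fieldExtType 'F_2) (b : 2.-tuple L) : basis_of fullv b ->
  b`_1 ^+ 2 = b`_0 ^+ 2 + b`_0 * b`_1.
Proof.
move=> bP; have bf := basis_free bP.
have add2 (x : L) : x + x = 0 by apply: addF2.
have b_neq (i : 'I_2) (c : 'F_2) : i != 1 :> nat -> b`_1 <> c *: b`_i.
  move=> i1 E; have := coord_free (1 : 'I_2) (1 : 'I_2) bf.
  rewrite /= E linearZ /= coord_free //.
  by rewrite -val_eqE /= (negPf i1) mulr0.
have b10 : b`_1 != 0 by apply/eqP => E; apply: (b_neq 0 0); rewrite ?scale0r.
have b1b0 : b`_1 != b`_0.
  by apply/eqP => E; apply: (b_neq 0 1); rewrite ?scale1r.
have b00 : b`_0 != 0.
  apply/eqP => E; have := coord_free (0 : 'I_2) (0 : 'I_2) bf.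
  by rewrite /= E linear0.
have : b`_1 ^+ 2 / b`_0 \in <<b>>%VS by rewrite (span_basis bP) memvf.
move/coord_span; rewrite !big_ord_recl big_ord0 addr0 /=.
set p := coord _ _ _; set q := coord _ _ _ => E.
have {}E : b`_1 ^+ 2 = p *: b`_0 ^+ 2 + q *: (b`_0 * b`_1).
  by rewrite -[LHS](divfK b00) E mulrDl -!scalerAl -expr2 [b`_1 * _]mulrC.
move: E; case: (ord2P p) => ->; case: (ord2P q) => ->;
  rewrite !(scale0r, scale1r, add0r, addr0) => E //.
- by move/eqP: E; rewrite expf_eq0 (negPf b10).
- move/eqP: E; rewrite expr2 -subr_eq0 -mulrBl mulf_eq0 subr_eq0.
  by rewrite (negPf b10) (negPf b1b0).
- have /eqP : (b`_1 + b`_0) ^+ 2 = 0.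
    rewrite sqrrD E mulr2n add2 addr0; exact: add2.
  rewrite expf_eq0 /= => /eqP E'; case/eqP: b1b0.
  by rewrite -[RHS]add0r -[X in _ = X + _]E' -addrA add2 addr0.
Qed.

Section TwoColumns.

Variables (L : fieldExtType 'F_2) (b : 2.-tuple L).
Hypothesis bP : basis_of fullv b.
Implicit Types (A B : 'M['F_2]_(4, 2)).
Implicit Types (W V : {vspace 'cV['F_2]_4}).

Variable C : {vspace 'M['F_2]_(4, 2)}.
Hypothesis dvdC : forall W, (2 %| \dim (shorten C W))%N.
Hypothesis dimC : \dim C = 4%N.
Hypothesis nondegC : forall W, W != fullv -> ~~ (C <= shorten fullv W)%VS.
Hypothesis no_point : forall w, w != 0 -> ~~ (shorten fullv <[w]> <= C)%VS.

(* Multiplication by [b`_1 / b`_0], a primitive cube root of unity. *)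
Definition omega_mx A : 'M['F_2]_(4, 2) :=
  \matrix_(i, j) (if j == 0 then A i 1 else A i 0 + A i 1).

Lemma contract_omega A :
  contract b (omega_mx A) = (b`_1 / b`_0) *: contract b A.
Proof.
have b00 : b`_0 != 0.
  apply/eqP => E; have := coord_free (0 : 'I_2) (0 : 'I_2) (basis_free bP).
  by rewrite /= E linear0.
apply/colP => i; rewrite !mxE !big_ord_recl !big_ord0 !mxE /= !addr0.
apply: (mulfI b00); rewrite mulrA mulrCA divff // mulr1.
rewrite (_ : bump 0 0 = 1%N) // (_ : ord0 = 0) // (_ : lift _ _ = 1); last exact: val_inj.
rewrite !(mulrDr, scalerDl) -!scalerAr -[b`_1 * b`_1]expr2 (F4_sqr bP) scalerDr.
by rewrite [b`_1 * b`_0]mulrC addrCA.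
Qed.

Lemma mx2P A B : col 0 A = col 0 B -> col 1 A = col 1 B -> A = B.
Proof.
move=> /colP E0 /colP E1; apply/matrixP => i j.
have := E0 i; have := E1 i; rewrite !mxE.
by case: (ord2P j) => ->.
Qed.

Lemma colsp_line A z : A \in C ->
  col 0 A \in <[z]>%VS -> col 1 A \in <[z]>%VS -> A = 0.
Proof.
move=> CA A0 A1; apply/eqP; apply: contraT => An0.
have := dim_colsp_ge2 (isT : 0 < 2)%N dvdC dimC nondegC no_point CA An0.
rewrite leqNgt ltnS (leq_trans (dimvS (_ : _ <= <[z]>)%VS)) //.
  by apply/colsp_subP => j; case: (ord2P j) => ->.
by rewrite dim_vline leq_b1.
Qed.

Lemma dim_colsp2 A : A \in C -> A != 0 -> \dim (colsp A) = 2%N.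
Proof.
move=> CA A0; apply/eqP; rewrite eqn_leq dim_colsp_le.
exact: (dim_colsp_ge2 _ dvdC dimC nondegC no_point CA A0).
Qed.

Lemma dim_shorten2 A : A \in C -> A != 0 -> \dim (shorten C (colsp A)) = 2%N.
Proof.
move=> CA A0; apply: (dim_shorten_colsp _ dvdC dimC nondegC CA A0) => //.
exact/dim2_proper/dim_colsp2.
Qed.

Lemma col_cases A z : (z \in colsp A) ->
  [\/ z = 0, z = col 0 A, z = col 1 A | z = col 0 A + col 1 A].
Proof.
have : (colsp A <= <[(col 0 A)%R]> + <[(col 1 A)%R]>)%VS.
  apply/colsp_subP => j; case: (ord2P j) => ->.
    by apply: (subvP (addvSl _ _)); apply: memv_line.
  by apply: (subvP (addvSr _ _)); apply: memv_line.
move=> /subvP/[apply]/memv_addP[_ /vlineP[p ->] [_ /vlineP[q ->] ->]].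
case: (ord2P p) => ->; case: (ord2P q) => ->; rewrite !(scale0r, scale1r, add0r, addr0).
- exact: Or41.
- exact: Or43.
- exact: Or42.
- exact: Or44.
Qed.

(** No nonzero word has a zero column or two equal columns, as its rank would be below 2.
    [C(colsp A)] has dimension 2, so it contains some [B] outside [<[A]>]; comparing columns of [B]
    and [A + B] with those of [A] shows that one of these two is [omega_mx A]. *)
Lemma omega_closed A : A \in C -> omega_mx A \in C.
Proof.
move=> CA; have [->|A0] := eqVneq A 0.
  rewrite (_ : omega_mx 0 = 0) ?mem0v //.
  by apply/matrixP => i j; rewrite !mxE addr0 if_same.
set v := col 0 A; set w := col 1 A.
have zero_cols B : B \in C -> col 0 B = 0 \/ col 1 B = 0 \/ col 0 B = col 1 B -> B = 0.
  move=> BC [B0|[B1|B01]].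
  - by apply: (colsp_line (z := col 1 B)) => //; rewrite ?B0 ?mem0v ?memv_line.
  - by apply: (colsp_line (z := col 0 B)) => //; rewrite ?B1 ?mem0v ?memv_line.
  - by apply: (colsp_line (z := col 1 B)) => //; rewrite ?B01 ?memv_line.
have colB (B : 'M['F_2]_(4, 2)) j : B \in shorten C (colsp A) -> col j B \in colsp A.
  by rewrite mem_shorten => /andP[_ /colsp_subP].
have subC B : B \in shorten C (colsp A) -> B \in C.
  by rewrite mem_shorten => /andP[].
have AA : A \in shorten C (colsp A) by rewrite mem_shorten CA subvv.
have colD B B' j : col j (B + B') = col j B + col j B' by rewrite linearD.
have step B : B \in shorten C (colsp A) -> col 0 B = w -> omega_mx A \in C.
  move=> BA B0; suff <- : B = omega_mx A by apply: subC.
  have w0 : w <> 0 by move=> w0; case/eqP: A0; apply: zero_cols; auto.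
  have B1 : col 1 B = v + w.
    case: (col_cases (colB _ 1 BA)) => // B1.
    - by case: w0; rewrite -B0 (zero_cols _ (subC _ BA)) ?linear0; auto.
    - have vw : v = w.
        have : A + B = 0.
          apply: zero_cols; first by rewrite memvD // subC.
          by right; right; rewrite !colD B0 B1 addrC.
        move=> /(congr1 (col 0)); rewrite colD B0 linear0 => E.
        by rewrite -[RHS]add0r -E -addrA addF2 addr0.
      by case/eqP: A0; apply: zero_cols; auto.
    - by case: w0; rewrite -B0 (zero_cols _ (subC _ BA)) ?linear0 // B0 B1; auto.
  apply: mx2P; first by rewrite B0; apply/colP => i; rewrite !mxE.
  by rewrite B1; apply/colP => i; rewrite !mxE.
have [B BA BnA] : exists2 B, B \in shorten C (colsp A) & B \notin <[A]>%VS.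
  apply/subvPn; apply/negP => /dimvS; rewrite dim_shorten2 // dim_vline.
  by case: (A != 0).
have contr B' : B' \notin <[A]>%VS -> B' <> 0 by move=> /[swap] ->; rewrite mem0v.
(* The first column of [B] is neither [0] nor [v]. If it is [v + w], adding [A] turns it into
   [w]. *)
case: (col_cases (colB _ 0 BA)) => B0.
- by case: (contr _ BnA); apply: zero_cols; auto.
- have : A + B = 0.
    apply: zero_cols; first by rewrite memvD // subC.
    by left; rewrite colD B0 addF2.
  move=> E; case/negP: BnA; rewrite -[B](addKr A) E addr0 rpredN; exact: memv_line.
- exact: step BA B0.
- apply: (step (A + B)); first exact: memvD.
  by rewrite colD B0 addrA addF2 add0r.
Qed.

(** The plane [C(colsp A)] is spanned by [A] and [omega_mx A]: if these were proportional, the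
    columns of [A] would be dependent. *)
Lemma contract_line A B : A \in C -> A != 0 -> B \in shorten C (colsp A) ->
  contract b B \in <[contract b A]>%VS.
Proof.
move=> CA A0; have wA : omega_mx A \notin <[A]>%VS.
  apply/vlineP => -[c E]; case/eqP: A0.
  move: E; case: (ord2P c) => ->; rewrite ?scale0r ?scale1r => E.
    apply: (colsp_line (z := col 0 A)) => //; rewrite ?memv_line //.
    suff -> : col 1 A = 0 by apply: mem0v.
    by apply/colP => i; move/matrixP/(_ i 0): E; rewrite !mxE.
  apply: (colsp_line (z := col 0 A)) => //; rewrite ?memv_line //.
  suff -> : col 1 A = col 0 A by apply: memv_line.
  by apply/colP => i; move/matrixP/(_ i 0): E; rewrite !mxE.
have AA : A \in shorten C (colsp A) by rewrite mem_shorten CA subvv.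
have wAA : omega_mx A \in shorten C (colsp A).
  rewrite mem_shorten omega_closed //=; apply/colsp_subP => j.
  have /colsp_subP cA := subvv (colsp A).
  have [->|j0] := eqVneq j 0.
    suff -> : col 0 (omega_mx A) = col 1 A by [].
    by apply/colP => i; rewrite !mxE.
  suff -> : col j (omega_mx A) = col 0 A + col 1 A by rewrite memvD.
  by apply/colP => i; rewrite !mxE (negPf j0).
have /eqP <- : (<[A]> + <[omega_mx A]> == shorten C (colsp A))%VS.
  by rewrite eqEdim subv_add -!memvE AA wAA dim_shorten2 // dim_plane.
move=> /memv_addP[_ /vlineP[p ->] [_ /vlineP[q ->] ->]].
by rewrite contractD // !contractZ contract_omega memvD ?memvZ ?memv_line.
Qed.

Lemma scale_closed A k : A \in C -> expand b (k *: contract b A) \in C.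
Proof.
move=> CA; have b00 : b`_0 != 0.
  apply/eqP => E; have := coord_free (0 : 'I_2) (0 : 'I_2) (basis_free bP).
  by rewrite /= E linear0.
(* Writing [k b_0 = p b_0 + q b_1] expresses [k] as [p] plus [q] times the cube root of unity. *)
have : k * b`_0 \in <<b>>%VS by rewrite (span_basis bP) memvf.
move/coord_span; rewrite !big_ord_recl big_ord0 addr0 /=.
set p := coord _ _ _; set q := coord _ _ _ => E.
have -> : k *: contract b A = contract b (p *: A + q *: omega_mx A).
  rewrite contractD // !contractZ contract_omega scalerA -scalerDl.
  congr (_ *: _); apply: (mulIf b00); rewrite E mulrDl -!mulrA mulVf // mulr1.
  by rewrite !mulr_algl.
by rewrite contractK // memvD // memvZ // omega_closed.
Qed.

Lemma same_dims_two_columns : exists C', same_dims b C C'.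
Proof.
have C0 : C != 0%VS by rewrite -dimv_eq0 dimC.
pose A := vpick C; have CA : A \in C := memv_pick C.
have A0 : A != 0 by rewrite vpick0.
have [B BC BA] : exists2 B, B \in C & B \notin shorten C (colsp A).
  by apply/subvPn; apply/negP => /dimvS; rewrite dimC dim_shorten2.
have B0 : B != 0 by apply: contra BA => /eqP ->; apply: mem0v.
have dA := dim_colsp2 CA A0; have dB := dim_colsp2 BC B0.
exists (<[contract b A]> + <[contract b B]>)%VS.
apply: (same_dims_span2 _ bP dvdC dimC nondegC no_point) => // W W2.
apply/eqP/eqP => [CW|C'W].
  apply/eqP; rewrite -subv0; apply/subvP => x; rewrite mem_vshorten // memv0.
  case/andP => /memv_addP[_ /vlineP[k ->] [_ /vlineP[l ->] ->]] xW.
  rewrite -(can_eq (expandK bP)) expand0 -memv0 -CW mem_shorten xW andbT.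
  by rewrite expandD memvD // scale_closed.
apply/eqP; rewrite -subv0; apply/subvP => X; rewrite mem_shorten memv0.
(* A word of [C] splits into words on the column spaces of [A] and [B], which contract into the two
   lines generating [C']. *)
rewrite -{1}(shorten_colsp_sum _ dvdC dimC nondegC no_point CA BC dA dB BA) //.
case/andP => /memv_addP[Y YA [Z ZB E]] XW.
rewrite -(contract_eq0 bP) -memv0 -C'W mem_vshorten // supp_contract // XW andbT.
rewrite E contractD // memv_add //; first exact: contract_line YA.
exact: contract_line ZB.
Qed.

End TwoColumns.

(** * Three columns *)

Section CoordinateSpan.

Variables (n m : nat) (L : fieldExtType 'F_2) (b : m.-tuple L).
Hypothesis bP : basis_of fullv b.
Implicit Types (x y : 'cV[L]_n) (u : 'cV['F_2]_n).

Definition dotL x u : L := \sum_i u i 0 *: x i 0.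

Fact dotL_is_linear x : linear (dotL x).
Proof.
move=> c u v; rewrite /dotL scaler_sumr -big_split; apply: eq_bigr => i _ /=.
by rewrite !mxE scalerDl scalerA.
Qed.

HB.instance Definition _ x :=
  GRing.isLinear.Build 'F_2 'cV['F_2]_n L _ (dotL x) (dotL_is_linear x).

(** The image of all binary combinations: the ['F_2]-span of the coordinates of [x] in [L], a
    basis-free counterpart of the row space of [expand b x]. *)
Definition coord_span x : {vspace L} := limg (linfun (dotL x)).

Lemma dotL_eq0 x u : (dotL x u == 0) = (u \in ortho (supp b x)).
Proof.
have -> : (u \in ortho (supp b x)) = (supp b x <= ortho <[u]>)%VS.
  by rewrite mem_ortho_sym memvE.
have E j : coord b j (dotL x u) = \sum_i u i 0 * (expand b x) i j.
  by rewrite linear_sum; apply: eq_bigr => i _; rewrite linearZ !mxE.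
apply/eqP/colsp_subP => [x0 j|xu].
  apply/mem_ortho => _ /vlineP[c ->].
  under eq_bigr => i _ do rewrite !mxE -mulrA.
  rewrite -mulr_sumr [X in _ * X](_ : _ = 0) ?mulr0 //.
  have := E j; rewrite x0 linear0 => E0; rewrite [RHS]E0.
  by apply: eq_bigr => i _; rewrite mxE.
rewrite (coord_basis bP (memvf (dotL x u))) big1 // => j _; rewrite E.
have /mem_ortho/(_ u (memv_line u)) := xu j.
under eq_bigr => i _ do rewrite mxE.
by move=> ->; rewrite scale0r.
Qed.

(** Row rank equals column rank, by rank-nullity for [dotL x]. *)
Lemma dim_coord_span x : \dim (coord_span x) = \dim (supp b x).
Proof.
have := limg_ker_dim (linfun (dotL x)) fullv.
have -> : lker (linfun (dotL x)) = ortho (supp b x).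
  by apply/vspaceP => u; rewrite memv_ker lfunE dotL_eq0.
rewrite capfv dim_ortho dimvf dim_matrix mulr1 -/(coord_span x) => E.
by apply/eqP; rewrite -(eqn_add2l (n - \dim (supp b x))) E subnK ?dim_col_le.
Qed.

Lemma dotLD x y (g : L) u : dotL (x + g *: y) u = dotL x u + g * dotL y u.
Proof.
rewrite /dotL mulr_sumr -big_split; apply: eq_bigr => i _ /=.
by rewrite !mxE scalerDr scalerAr.
Qed.

(** Disjoint supports have complements that add up to the whole space, so [u = u1 + u2] with [u1]
    orthogonal to [x] and [u2] to [y]. Testing [x + g *: y] against [u2] isolates [x], against [u1]
    it isolates [g *: y]. *)
Lemma coord_span_add x y (g : L) :
  (supp b x :&: supp b y = 0)%VS ->
  (coord_span x <= coord_span (x + g *: y))%VS /\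
  {in coord_span y, forall s, g * s \in coord_span (x + g *: y)}.
Proof.
move=> xy0; have sum_ortho : (ortho (supp b x) + ortho (supp b y))%VS = fullv.
  rewrite -[LHS]orthoK; set T := ortho (_ + _).
  have -> : T = 0%VS; last by rewrite -(ortho_full n) orthoK.
  apply/eqP; rewrite -subv0 -xy0 subv_cap -{1}[supp b x]orthoK -{1}[supp b y]orthoK.
  by rewrite 2!(mem_ortho_sym T) /T !orthoK addvSl addvSr.
have dec u : exists u1 u2, [/\ u = u1 + u2, dotL x u1 = 0 & dotL y u2 = 0].
  have : u \in (ortho (supp b x) + ortho (supp b y))%VS by rewrite sum_ortho memvf.
  case/memv_addP => u1 x1 [u2 y2 ->]; exists u1, u2; split=> //; apply/eqP;
    by rewrite dotL_eq0.
have mem z u : dotL z u \in coord_span z.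
  by have := memv_img (linfun (dotL z)) (memvf u); rewrite lfunE.
split=> [|_ /memv_imgP[u _ ->]]; last rewrite lfunE.
  apply/subvP => _ /memv_imgP[u _ ->]; rewrite lfunE /=.
  have [u1 [u2 [-> x1 y2]]] := dec u.
  have <- : dotL (x + g *: y) u2 = dotL x (u1 + u2).
    by rewrite dotLD y2 mulr0 addr0 linearD /= x1 add0r.
  exact: mem.
have [u1 [u2 [-> x1 y2]]] := dec u.
have <- : dotL (x + g *: y) u1 = g * dotL y (u1 + u2).
  by rewrite dotLD x1 add0r linearD /= y2 addr0.
exact: mem.
Qed.

End CoordinateSpan.

(** The degree 3 is prime, so a [g] outside ['F_2] generates [L]. Then [S] would be a nonzero
    [L]-subspace of [L], hence all of it. *)
Lemma stable_scalar (L : fieldExtType 'F_2) (S : {vspace L}) (g : L) :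
  \dim {:L} = 3%N -> \dim S = 2%N -> {in S, forall s, g * s \in S} ->
  g = 0 \/ g = 1.
Proof.
move=> dL dS gS.
have dg3 : (\dim <<1; g>> %| 3)%N by rewrite -dL; apply: field_dimS; apply: subvf.
have [_ /(_ _ dg3) /orP[] /eqP dg] := primeP (isT : prime 3).
  have : g \in 1%VS.
    suff /eqP -> : 1%VS == <<1; g>>%VS by apply: memv_adjoin.
    by rewrite eqEdim subv_adjoin dg dimv1.
  by case/vlineP => c ->; case: (ord2P c) => ->; rewrite ?scale0r ?scale1r; auto.
have gT : <<1; g>>%VS = fullv by apply/eqP; rewrite eqEdim subvf dg dL.
have s0 : vpick S != 0 by rewrite vpick0 -dimv_eq0 dS.
suff Sf : (fullv <= S)%VS by have := dimvS Sf; rewrite dL dS.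
apply/subvP => v _; rewrite -(divfK s0 v).
(* Any [v] is a binary polynomial in [g] times a fixed nonzero element of [S], and powers of [g]
   preserve [S]. *)
have /Fadjoin_polyP[p /polyOverP p1 ->] : v / vpick S \in <<1; g>>%VS.
  by rewrite gT memvf.
rewrite horner_coef mulr_suml; apply: memv_suml => i _.
have /vlineP[c ->] := p1 i; rewrite -mulrA mulr_algl memvZ //.
elim: (i : nat) => [|j IH]; first by rewrite expr0 mul1r memv_pick.
by rewrite exprS -mulrA gS.
Qed.

(** * Counting the words of rank two *)

Section ThreeColumns.

Variable C : {vspace 'M['F_2]_(4, 3)}.
Hypothesis dvdC : forall W, (3 %| \dim (shorten C W))%N.
Hypothesis dimC : \dim C = 6%N.
Hypothesis nondegC : forall W, W != fullv -> ~~ (C <= shorten fullv W)%VS.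
Hypothesis no_point : forall w, w != 0 -> ~~ (shorten fullv <[w]> <= C)%VS.
Implicit Types (A B : 'M['F_2]_(4, 3)) (u : 'cV['F_2]_4).

Let rank_ge2 := dim_colsp_ge2 (isT : 0 < 3)%N dvdC dimC nondegC no_point.

Definition rank2_words : {set 'M['F_2]_(4, 3)} :=
  [set A in C | \dim (colsp A) == 2%N].

Lemma dim_ortho_line u : u != 0 -> \dim (ortho <[u]>) = 3%N.
Proof. by move=> u0; rewrite dim_ortho dim_vline u0. Qed.

(** The dimension is a multiple of 3, at least [6 + 9 - 12 = 3], and below 6 by nondegeneracy. *)
Lemma card_shorten_hyperplane u :
  u != 0 -> #|shorten C (ortho <[u]>)| = 8%N.
Proof.
move=> u0; rewrite card_vspace card_Fp //.
have dH := dim_ortho_line u0.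
have Hf : ortho <[u]>%VS != fullv by apply/eqP => E; have := dim4; rewrite -E dH.
rewrite (dim_shorten_lt2m _ dvdC (dim_shorten_proper dimC nondegC Hf)) //.
rewrite -dimv_eq0; have := dim_shorten_ge (W := ortho <[u]>) (V := fullv) (C := C).
rewrite shortenT !subvf dim4 dH dimC => /(_ isT isT).
by case: (\dim _).
Qed.

Lemma card_orthogonal A : #|[pred u | A \in shorten C (ortho <[u]>)]| =
  ((A \in C) * 2 ^ (4 - \dim (colsp A)))%N.
Proof.
have [AinC|nAC] := boolP (A \in C); last first.
  by rewrite mul0n; apply: eq_card0 => u; rewrite inE mem_shorten (negPf nAC).
rewrite mul1n -dim_ortho -[X in (X ^ _)%N](card_Fp (isT : prime 2)) -card_vspace.
by apply: eq_card => u; rewrite inE mem_shorten AinC mem_ortho_sym memvE.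
Qed.

(* Double counting of the pairs [(A, u)] with [A] in [C] and [u] orthogonal to
   the columns of [A]: words of rank 2 are orthogonal to 4 vectors, words of
   rank 3 to 2 vectors. *)
Lemma card_rank2_words : #|rank2_words| = 21%N.
Proof.
have count : (\sum_(u : 'cV['F_2]_4) #|shorten C (ortho <[u]>)| =
    \sum_(A : 'M['F_2]_(4, 3)) #|[pred u | A \in shorten C (ortho <[u]>)]|)%N.
  under eq_bigr => u _ do rewrite -sum1_card.
  under [RHS]eq_bigr => A _ do rewrite -sum1_card.
  rewrite (exchange_big_dep xpredT) //=.
(* The vector [u = 0] contributes all 64 words and the other 15 vectors contribute 8 each. *)
have lhs : (\sum_(u : 'cV['F_2]_4) #|shorten C (ortho <[u]>)| = 184)%N.
  rewrite (bigD1 0) //= (eq_bigr (fun=> 8%N)); last first.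
    by move=> u u0; apply: card_shorten_hyperplane.
  rewrite sum_nat_const (_ : <[0]>%VS = 0%VS); last first.
    by apply/eqP; rewrite -subv0 -memvE mem0v.
  rewrite -(ortho_full 4) orthoK shortenT card_vspace card_Fp // dimC.
  rewrite (_ : #|_| = 15%N) //.
  have := cardC1 (0 : 'cV['F_2]_4); rewrite card_mx card_Fp //.
have card_nz : #|[set A in C | A != 0]| = 63%N.
  have := cardsD1 (0 : 'M['F_2]_(4, 3)) [set A in C].
  rewrite inE mem0v cardsE card_vspace card_Fp // dimC => /eqP.
  rewrite (_ : 2 ^ 6 = true + 63)%N // eqn_add2l => /eqP ->.
  by apply: eq_card => A; rewrite !inE andbC.
(* The zero word contributes 16, each of the 63 nonzero words contributes 2, and words of rank 2
   contribute 2 more. *)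
have rhs : (\sum_(A : 'M['F_2]_(4, 3)) #|[pred u | A \in shorten C (ortho <[u]>)]|
    = 16 + (2 * 63 + 2 * #|rank2_words|))%N.
  rewrite (bigD1 0) //= card_orthogonal mem0v; congr (_ + _)%N.
    suff -> : colsp (0 : 'M['F_2]_(4, 3)) = 0%VS by rewrite dimv0.
    by apply/eqP; rewrite -subv0 colsp_subv0.
  rewrite -card_nz -!sum1_card !big_distrr /= !muln1.
  rewrite [X in (X + _)%N]big_mkcond [X in (_ + X)%N]big_mkcond -big_split.
  rewrite big_mkcond; apply: eq_bigr => A _ /=; rewrite card_orthogonal !inE.
  have [-> /=|A0] := eqVneq A 0.
    rewrite andbF (_ : \dim (colsp 0) = 0%N) ?andbF //.
    by apply/eqP; rewrite dimv_eq0 -subv0 colsp_subv0.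
  have [AinC /=|//] := boolP (A \in C).
  have := rank_ge2 AinC A0; have := dim_colsp_le A.
  by case: (\dim (colsp A)) => [|[|[|[|]]]].
move: count; rewrite lhs rhs; lia.
Qed.

Definition words_on (W : {vspace 'cV['F_2]_4}) : {set 'M['F_2]_(4, 3)} :=
  [set X in C | colsp X == W].

Lemma rank2_neq0 A : \dim (colsp A) = 2%N -> A != 0.
Proof.
move=> dA; apply/eqP => A0; have := colsp_subv0 A.
by rewrite A0 eqxx subv0 -A0 -dimv_eq0 dA.
Qed.

(** [C(colsp A)] has 8 words, and each of the 7 nonzero ones has rank at least 2, so fills the
    plane. *)
Lemma card_words_on A : A \in rank2_words -> #|words_on (colsp A)| = 7%N.
Proof.
rewrite inE => /andP[AinC /eqP dA].
have := cardsD1 (0 : 'M['F_2]_(4, 3)) [set X in shorten C (colsp A)].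
have A0 := rank2_neq0 dA.
rewrite inE mem0v cardsE card_vspace card_Fp //.
rewrite (dim_shorten_colsp _ dvdC dimC nondegC AinC A0 (dim2_proper dA)) //.
rewrite (_ : 2 ^ 3 = true + 7)%N // => /eqP; rewrite eqn_add2l => /eqP ->.
apply: eq_card => X; rewrite !inE mem_shorten.
have [XC /=|] := boolP (X \in C); last by rewrite andbF.
apply/eqP/andP => [E|[X0 XA]].
  by rewrite E subvv rank2_neq0 ?E.
by apply: (colsp_rank2 _ dvdC dimC nondegC no_point XC X0 _ XA); rewrite ?dA.
Qed.

(** Sorting the 21 words by column space gives classes of 7, hence exactly three planes, which are
    lines of the projective space. *)
Lemma exists_three_lines : exists A1 A2 A3,
  [/\ [/\ A1 \in rank2_words, A2 \in rank2_words & A3 \in rank2_words],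
      [/\ colsp A2 != colsp A1, colsp A3 != colsp A1 & colsp A3 != colsp A2] &
      forall X, X \in rank2_words ->
        colsp X \in [:: colsp A1; colsp A2; colsp A3]].
Proof.
have pick (S : {set 'M['F_2]_(4, 3)}) : (#|S| < 21)%N ->
    exists2 X, X \in rank2_words & X \notin S.
  move=> S21; apply/subsetPn; apply: contraL S21 => /subset_leq_card.
  by rewrite card_rank2_words -leqNgt.
have sub A : A \in rank2_words -> words_on (colsp A) \subset rank2_words.
  rewrite inE => /andP[_ dA]; apply/subsetP => X.
  by rewrite !inE => /andP[-> /eqP ->].
have disj A B : colsp B != colsp A -> words_on (colsp A) :&: words_on (colsp B) = set0.
  move=> BA; apply/setP => X; rewrite !inE; apply/negP => /andP[/andP[_ /eqP XA]].
  by rewrite XA (eq_sym _ (colsp B)) (negPf BA) andbF.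
have notin A B : A \in rank2_words -> A \notin words_on (colsp B) -> colsp A != colsp B.
  by rewrite !inE => /andP[-> _].
have [A1 r1 _] : exists2 X, X \in rank2_words & X \notin set0.
  by apply: pick; rewrite cards0.
have [A2 r2 /(notin _ _ r2) A21] : exists2 X, X \in rank2_words & X \notin words_on (colsp A1).
  by apply: pick; rewrite card_words_on.
pose S := words_on (colsp A1) :|: words_on (colsp A2).
have cS : #|S| = 14%N by rewrite cardsU disj // cards0 !card_words_on.
have [A3 r3 A3S] : exists2 X, X \in rank2_words & X \notin S.
  by apply: pick; rewrite cS.
move: A3S; rewrite inE negb_or => /andP[/(notin _ _ r3) A31 /(notin _ _ r3) A32].
exists A1, A2, A3; split=> // X.
suff <- : S :|: words_on (colsp A3) = rank2_words.
  by rewrite !inE -orbA -!andb_orr => /andP[_ ->].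
apply/eqP; rewrite eqEcard !subUset !sub // card_rank2_words cardsU cS.
by rewrite card_words_on // setIUl !disj // setU0 cards0.
Qed.

(** [C] is the direct sum of its parts on the first two planes. The components of a word on the
    third plane are nonzero, so they are the required [A] and [B]. *)
Lemma exists_regular_lines : exists A B,
  [/\ [/\ A \in rank2_words, B \in rank2_words & A + B \in rank2_words],
      B \notin shorten C (colsp A) &
      forall X, X \in rank2_words ->
        colsp X \in [:: colsp A; colsp B; colsp (A + B)]].
Proof.
have [A1 [A2 [A3 [[r1 r2 r3] [A21 A31 A32] all3]]]] := exists_three_lines.
move: (r1) (r2) (r3); rewrite !inE => /andP[C1 /eqP d1] /andP[C2 /eqP d2] /andP[C3 /eqP d3].
have neq_shorten X Y : X \in C -> Y \in C -> \dim (colsp X) = 2%N -> \dim (colsp Y) = 2%N ->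
    colsp Y != colsp X -> Y \notin shorten C (colsp X).
  move=> CX CY dX dY; apply: contra; rewrite mem_shorten => /andP[_ YX].
  by rewrite eqEdim YX dX dY.
have n21 := neq_shorten _ _ C1 C2 d1 d2 A21.
have := C3; rewrite -{1}(shorten_colsp_sum _ dvdC dimC nondegC no_point C1 C2 d1 d2 n21) //.
case/memv_addP => X X1 [Y Y2 E].
have X0 : X != 0.
  apply: contra (neq_shorten _ _ C2 C3 d2 d3 A32) => /eqP X0.
  by rewrite E X0 add0r.
have Y0 : Y != 0.
  apply: contra (neq_shorten _ _ C1 C3 d1 d3 A31) => /eqP Y0.
  by rewrite E Y0 addr0.
move: X1 Y2; rewrite !mem_shorten => /andP[CX X1] /andP[CY Y2].
have cX : colsp X = colsp A1.
  by apply: (colsp_rank2 _ dvdC dimC nondegC no_point CX X0 _ X1); rewrite ?d1.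
have cY : colsp Y = colsp A2.
  by apply: (colsp_rank2 _ dvdC dimC nondegC no_point CY Y0 _ Y2); rewrite ?d2.
exists X, Y; split.
- by rewrite -E !inE CX CY C3 cX cY d1 d2 d3.
- by apply: neq_shorten; rewrite ?cX ?cY.
- by move=> Z /all3; rewrite -E cX cY.
Qed.

(** The nonzero vectors of [C'] with support of dimension at most 2 are the multiples of [A], [B]
    and [A + B], whose column spaces are exactly those of the words of [C] of rank 2. *)
Lemma same_dims_three_columns (L : fieldExtType 'F_2) (b : 3.-tuple L) :
  basis_of fullv b -> exists C', same_dims b C C'.
Proof.
move=> bP; have dL : \dim {:L} = 3%N by rewrite -(size_basis bP).
have [A [B [[rA rB rAB] BA all3]]] := exists_regular_lines.
move: rA rB rAB; rewrite !inE => /andP[CA /eqP dA] /andP[CB /eqP dB] /andP[CAB /eqP dAB].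
have dT := colsp_add_full (isT : 0 < 3)%N dvdC dimC nondegC no_point CA CB dA dB BA.
have cap0 : (supp b (contract b A) :&: supp b (contract b B))%VS = 0%VS.
  rewrite !supp_contract //; apply/eqP; rewrite -dimv_eq0.
  by have := dimv_sum_cap (colsp A) (colsp B); rewrite dT dim4 dA dB => E; rewrite -(eqn_add2l 4) E.
(* A word of rank at most 2 on the line through [A] and [B] has the same
   coordinate span [S] as [A], [B] and [A + B]; then [g] maps [S] into itself,
   which for [g] outside ['F_2] would make [S] an [L]-subspace of [L]. *)
have third g W : g != 0 -> (\dim W <= 2)%N ->
    (supp b (contract b A + g *: contract b B) <= W)%VS -> g = 1.
  move=> g0 W2 xW.
  have dim2 X : \dim (colsp X) = 2%N -> \dim (coord_span (contract b X)) = 2%N.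
    by move=> dX; rewrite (dim_coord_span bP) supp_contract.
  have [SA SB] := coord_span_add bP g cap0.
  have [TA TB] := coord_span_add bP 1 cap0.
  have eS : coord_span (contract b A) = coord_span (contract b A + g *: contract b B).
    apply/eqP; rewrite eqEdim SA dim2 // (dim_coord_span bP).
    exact: leq_trans (dimvS xW) W2.
  have eA : coord_span (contract b A) = coord_span (contract b (A + B)).
    apply/eqP; rewrite eqEdim !dim2 // contractD //= andbT.
    by rewrite -[X in _ + X]scale1r.
  have eB : coord_span (contract b B) = coord_span (contract b A).
    apply/eqP; rewrite eqEdim !dim2 // andbT eA contractD //.
    apply/subvP => s /TB; rewrite mul1r scale1r; exact.
  case: (stable_scalar (g := g) dL (dim2 _ _ dA)) => //.
    by move=> s; rewrite {2}eS -eB => /SB.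
  by move=> g0'; rewrite g0' eqxx in g0.
exists (<[contract b A]> + <[contract b B]>)%VS.
apply: (same_dims_span2 _ bP dvdC dimC nondegC no_point) => // W W2.
apply/eqP/eqP => [CW|C'W]; apply/eqP; rewrite -subv0; apply/subvP => x.
  rewrite mem_vshorten // memv0.
  case/andP => /memv_addP[_ /vlineP[k ->] [_ /vlineP[l ->] ->]].
  have nW X : X \in C -> \dim (colsp X) = 2%N -> ~~ (colsp X <= W)%VS.
    move=> XC dX; apply: contraNN (rank2_neq0 dX) => XW.
    by rewrite -memv0 -CW mem_shorten XC.
  have [->|k0] := eqVneq k 0.
    rewrite scale0r add0r; have [->|l0] := eqVneq l 0; first by rewrite scale0r.
    by rewrite supp_scale // supp_contract // (negPf (nW _ CB dB)).
  have [->|l0] := eqVneq l 0.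
    by rewrite scale0r addr0 supp_scale // supp_contract // (negPf (nW _ CA dA)).
  have -> : k *: contract b A + l *: contract b B =
      k *: (contract b A + (l / k) *: contract b B).
    by rewrite scalerDr scalerA mulrCA divff // mulr1.
  rewrite supp_scale // => xW.
  have g1 : l / k = 1 by apply: third xW; rewrite // mulf_neq0 // invr_eq0.
  move: xW; rewrite g1 scale1r -contractD // supp_contract //.
  by rewrite (negPf (nW _ CAB dAB)).
(* Conversely, a nonzero word of [C(W)] lies on one of the three planes, so [W] is that plane and
   supports a nonzero vector of [C']. *)
rewrite mem_shorten memv0 => /andP[XC XW]; apply: contraT => X0.
have cX := colsp_rank2 (isT : 0 < 3)%N dvdC dimC nondegC no_point XC X0 W2 XW.
have dX : \dim (colsp x) = 2%N.
  apply/eqP; rewrite eqn_leq; apply/andP; split; last exact: rank_ge2.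
  by rewrite cX.
have nW Y : contract b Y \in (<[contract b A]> + <[contract b B]>)%VS ->
    \dim (colsp Y) = 2%N -> (colsp x == colsp Y) = false.
  move=> YC dY; apply/negP => /eqP E; case/negP: (rank2_neq0 dY).
  by rewrite -(contract_eq0 bP) -memv0 -C'W mem_vshorten_contract // YC -E cX subvv.
have := all3 x; rewrite !inE XC dX => /(_ isT).
have mA : contract b A \in (<[contract b A]> + <[contract b B]>)%VS.
  by apply: (subvP (addvSl _ _)); apply: memv_line.
have mB : contract b B \in (<[contract b A]> + <[contract b B]>)%VS.
  by apply: (subvP (addvSr _ _)); apply: memv_line.
by rewrite !nW // contractD // memvD.
Qed.

End ThreeColumns.

(** * Assembling the cases *)

Lemma same_dims_extreme (n m k : nat) (L : fieldExtType 'F_2) (b : m.-tuple L)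
    (C : {vspace 'M['F_2]_(n, m)}) :
  (0 < m)%N -> basis_of fullv b ->
  (forall W, (m %| \dim (shorten C W))%N) -> \dim C = (k * m)%N ->
  (k <= 1)%N || (n <= k.+1)%N -> exists C', same_dims b C C'.
Proof.
move=> m0 bP dvdC dC.
have kn : (k <= n)%N.
  have := dim_shorten_le C fullv.
  by rewrite shortenT dC dimvf dim_matrix mulr1 leq_pmul2r.
case: k dC kn => [|[|k]] dC kn ext.
- by exists 0%VS; apply: same_dims0.
- have C0 : C != 0%VS by rewrite -dimv_eq0 dC mul1n -lt0n.
  rewrite mul1n in dC; exists <[contract b (vpick C)]>%VS.
  by apply: same_dims1 => //; rewrite ?memv_pick ?vpick0.
move: ext; rewrite /= leq_eqVlt => /predU1P[nk|nk].
  apply: (same_dims_corank1 m0 bP dvdC (W0 := fullv)).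
    by apply/subvP => A _; rewrite mem_shorten memvf subvf.
  by rewrite dC dimvf dim_matrix mulr1 [in RHS]nk [in RHS]mulSn addnC.
exists fullv; apply: same_dims_full => //.
by rewrite dC; congr (_ * _)%N; apply/eqP; rewrite eqn_leq kn.
Qed.

Lemma same_dims_rank2_dim4 (m : nat) (L : fieldExtType 'F_2) (b : m.-tuple L)
    (C : {vspace 'M['F_2]_(4, m)}) :
  (1 < m < 4)%N -> basis_of fullv b ->
  (forall W, (m %| \dim (shorten C W))%N) -> \dim C = m.*2 ->
  exists C', same_dims b C C'.
Proof.
move=> m14 bP dvdC dC; have m0 : (0 < m)%N by case/andP: m14 => /ltnW.
have [/existsP[u /andP[u0 Cu]]|degC] :=
    boolP [exists u : 'cV['F_2]_4, (u != 0) && (C <= shorten fullv (ortho <[u]>))%VS].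
  (* Inside a hyperplane of dimension 3, dimension [2m] means codimension [m]. *)
  by apply: (same_dims_corank1 m0 bP dvdC Cu); rewrite dim_ortho_line // dC; lia.
have nondegC W : W != fullv -> ~~ (C <= shorten fullv W)%VS.
  (* A proper [W] lies in the hyperplane orthogonal to any nonzero vector of [ortho W]. *)
  move=> Wf; apply: contra degC => CW; apply/existsP; exists (vpick (ortho W)).
  rewrite vpick0 -dimv_eq0 dim_ortho subn_eq0 -ltnNge ltnS dim_lt4 //=.
  by rewrite (subv_trans CW) // shorten_fullS // mem_ortho_sym -memvE memv_pick.
have [/existsP[w /andP[w0 Tw]]|noT] :=
    boolP [exists w : 'cV['F_2]_4, (w != 0) && (shorten fullv <[w]> <= C)%VS].
  exact: (same_dims_point m0 bP dvdC dC nondegC w0 Tw).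
have no_point w : w != 0 -> ~~ (shorten fullv <[w]> <= C)%VS.
  by move=> w0; apply: contra noT => Tw; apply/existsP; exists w; rewrite w0.
case: m m14 L b C bP dvdC dC nondegC no_point {m0 degC noT} => [|[|[|[|]]]] // _ L b C bP.
  exact: same_dims_two_columns.
by move=> dvdC dC nondegC no_point; apply: same_dims_three_columns.
Qed.

Lemma not_purely_multilinear (n m : nat) (L : fieldExtType 'F_2) (b : m.-tuple L) :
  basis_of fullv b ->
  (forall C : {vspace 'M['F_2]_(n, m)}, (1 < m)%N ->
    (forall W, (m %| \dim (shorten C W))%N) -> exists C', same_dims b C C') ->
  ~ exists M : qmatroid n, purely_multilinear b M.
Proof.
move=> bP h [M [m1 [C hC] nM]]; apply: nM.
have m0 := ltnW m1; have [C' CC'] := h C m1 (representation_dvd m0 hC).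
exact: same_dims_representable CC'.
Qed.

Theorem theorem6p10 :
  (forall (m : nat) (L : fieldExtType 'F_2) (b : m.-tuple L),
      (1 < m)%N -> \dim {:L} = m -> basis_of {:L} b ->
      ~ exists M : qmatroid 3, purely_multilinear b M) /\
  (forall (m : nat) (L : fieldExtType 'F_2) (b : m.-tuple L),
      (1 < m < 4)%N -> \dim {:L} = m -> basis_of {:L} b ->
      ~ exists M : qmatroid 4, purely_multilinear b M).
Proof.
split=> m L b m1 _ bP; apply: not_purely_multilinear => // C /ltnW m0 dvdC.
  (* For [n = 3] every [k] satisfies [k <= 1] or [k >= n - 1]; for [n = 4] only [k = 2] escapes. *)
  have := dvdC fullv; rewrite shortenT => /dvdnP[k dC].
  by apply: (same_dims_extreme m0 bP dvdC dC); case: k dC => [|[|]].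
have := dvdC fullv; rewrite shortenT => /dvdnP[k dC].
have [k2|k2] := eqVneq k 2; last first.
  by apply: (same_dims_extreme m0 bP dvdC dC); case: k k2 dC => [|[|[|]]].
by apply: same_dims_rank2_dim4 => //; rewrite dC k2 mul2n.
Qed.
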